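(* Let $k,k'\in\mathbb{N}$, $\delta,\delta'\in\mathbb{R}$, and let $T:R^k_\delta\to R^{k'}_{\delta'}$ be an $\mathrm{sp}_{2n+2}$-invariant (linear) operator. Assume that $\delta\notin\mathfrak{C}_k$ and $\delta'\notin\mathfrak{C}_{k'}$. For any $\ell\in\{0,\dots,k\}$, the restriction $T_\ell$ of $T$ to $R^{k,\ell}_\delta$ either vanishes, or is an $\mathrm{sp}_{2n+2}$-invariant operator from $R^{k,\ell}_\delta$ into a space $R^{k',\ell'}_{\delta'}$, $\ell'\in\{0,\dots,k'\}$, where $\ell'$ verifies the equation $\varepsilon^{k',\ell'}_{\delta'}=\varepsilon^{k,\ell}_\delta$. Moreover, the map $\ell\mapsto\ell'$ (defined on those $\ell$ for which $T_\ell\neq0$) is injective.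
   Context: Let $n\ge1$, $(p_1,\dots,p_n,q^1,\dots,q^n,t)$ the canonical coordinates of $\mathbb{R}^{2n+1}$, $\alpha=\frac12(\sum_k(p_kdq^k-q^kdp_k)-dt)$ the standard contact form, and $\mathcal{E}_s=\sum_k(p_k\partial_{p_k}+q^k\partial_{q^k})$. The contact Hamiltonian vector field of $h\in C^\infty(\mathbb{R}^{2n+1})$ is $$X_h=\sum_k(\partial_{p_k}h\,\partial_{q^k}-\partial_{q^k}h\,\partial_{p_k})+\mathcal{E}_s(h)\,\partial_t-\partial_th\,\mathcal{E}_s-2h\,\partial_t.$$ The Lie algebra $\mathrm{sp}_{2n+2}$ is $\{X_h: h\text{ a polynomial of degree}\le2\text{ in }(p,q,t)\}$. For $k\in\mathbb{N}$, $\delta\in\mathbb{R}$, $\mathcal{S}^k_\delta(\mathbb{R}^{2n+1})=\Gamma(S^kT\mathbb{R}^{2n+1}\otimes\mathbb{F}_\delta)$ is the space of symmetric contravariant $k$-tensor fields with values in $\delta$-densities. Its elements are viewed as polynomials $S(\xi)$, homogeneous of degree $k$ in the fiber coordinates $\xi=(\xi_{p_i},\xi_{q^i},\xi_t)$, with coefficients in $C^\infty(\mathbb{R}^{2n+1})$. A vector field $Z=Z^i\partial_i$ acts on $P\in\mathcal{S}^k_\delta$ by $L_ZP=Z(P)-\partial_jZ^i\,\xi_i\,\partial_{\xi_j}P+\delta\,\partial_iZ^i\,P$. Put $R^k_\delta=\mathcal{S}^k_{\delta+\frac{k}{n+1}}(\mathbb{R}^{2n+1})$. An operator is $\mathrm{sp}_{2n+2}$-invariant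 if it commutes with the actions $L_Z$ for all $Z\in\mathrm{sp}_{2n+2}$. The operator $i_\alpha:R^k_\delta\to R^{k-1}_\delta$ is $$(i_\alpha S)(\xi)=\tfrac12\Big(\sum_j(p_j\partial_{\xi_{q^j}}-q^j\partial_{\xi_{p_j}})-\partial_{\xi_t}\Big)S(\xi)$$ (zero for $k=0$), and the generalized Hamiltonian $X:R^k_\delta\to R^{k+1}_\delta$ is $$X(S)(\xi)=\sum_j(\xi_{q^j}\partial_{p_j}-\xi_{p_j}\partial_{q^j})S(\xi)+\xi_t\,\mathcal{E}_sS(\xi)-\Big(\sum_j(p_j\xi_{p_j}+q^j\xi_{q^j})\Big)\partial_tS(\xi)+\big(2(n+1)\delta+k\big)\xi_tS(\xi).$$ Further notation: $\mathfrak{C}_k=\{-p/(2(n+1)):p=0,1,\dots,2k-2\}$. For $\ell\in\{0,\dots,k\}$, $R^{k,\ell}_\delta=X^\ell(R^{k-\ell}_\delta\cap\ker i_\alpha)\subset R^k_\delta$; for $\delta\notin\mathfrak{C}_k$ these are the eigenspaces (and submodules) of the Casimir operator of $\mathrm{sp}_{2n+2}$ acting on $R^k_\delta$, with eigenvalue $$\varepsilon^{k,\ell}_\delta=\frac1{n+2}\Big((n+1)^2\delta^2-(n+1)^2\delta+k(n+1)\delta+\frac{k^2-k}2-\frac\ell2\big(2(n+1)\delta+2k-\ell-1\big)\Big).$$ *)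

(* Defs.v *)
From HB Require Import structures.
From mathcomp Require Import all_boot all_order all_algebra.
From mathcomp Require Import all_classical all_reals all_analysis.
From mathcomp Require Import -(notations) mpoly.

Set Implicit Arguments.
Unset Strict Implicit.
Unset Printing Implicit Defensive.

Import Order.TTheory GRing.Theory Num.Theory.
Import numFieldNormedType.Exports.

Local Open Scope classical_set_scope.
Local Open Scope ring_scope.

Section SmoothFunctions.
Context {R : realType} {m : nat}.
Implicit Types (f g : 'rV[R]_m -> R) (i : 'I_m).

Definition unit_vec i : 'rV[R]_m := delta_mx 0 i.

Fixpoint Cr (r : nat) f : Prop :=
  continuous f /\
  if r is s.+1 then
    forall i, (forall x, derivable f x (unit_vec i)) /\
              Cr s (fun x => 'D_(unit_vec i) f x)
  else True.

Definition smooth f : Prop := forall r, Cr r f.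

Lemma Cr_continuous r f : Cr r f -> continuous f.
Proof. by case: r => [|r] []. Qed.

Lemma CrW r f : Cr r.+1 f -> Cr r f.
Proof.
elim: r f => [|r IH] f [cf Df]; first by split.
by split=> // i; have [df Cf] := Df i; split=> //; apply: IH.
Qed.

Lemma Cr_cst r (c : R) : Cr r (fun=> c).
Proof.
elim: r c => [|r IH] c; first by split=> // x; exact: cst_continuous.
split=> [x|i]; first exact: cst_continuous.
 split=> [x|]; first exact: derivable_cst.
have -> : (fun x => 'D_(unit_vec i) (fun=> c) x) = (fun=> 0).
  by apply/funext => x; exact: derive_cst.
exact: IH.
Qed.

Lemma Cr_linear r (c : R) f g :
  Cr r f -> Cr r g -> Cr r (c \*: f + g).
Proof.
elim: r f g => [|r IH] f g [cf Df] [cg Dg].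
all: have cfg : continuous (c \*: f + g) by
  move=> x; apply: continuousD (cg x); apply: continuousZ (cf x);
  exact: cst_continuous.
all: split=> //.
move=> i; have [df Cf] := Df i; have [dg Cg] := Dg i.
split=> [x|]; first by apply: derivableD => //; exact: derivableZ.
rewrite (_ : (fun x => _) = c \*: 'D_(unit_vec i) f + 'D_(unit_vec i) g).
  exact: IH.
by apply/funext => x; rewrite deriveD ?deriveZ //; exact: derivableZ.
Qed.

Lemma Cr_mul r f g : Cr r f -> Cr r g -> Cr r (f * g).
Proof.
elim: r f g => [|r IH] f g Hf Hg; have [cf Df] := Hf; have [cg Dg] := Hg.
all: have cfg : continuous (f * g) by move=> x; exact: continuousM (cf x) (cg x).
all: split=> //.
move=> i.
have [df Cf] := Df i; have [dg Cg] := Dg i.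
split=> [x|]; first exact: derivableM.
rewrite (_ : (fun x => _) =
    1 \*: (f * 'D_(unit_vec i) g) + g * 'D_(unit_vec i) f).
  by apply: Cr_linear; apply: IH => //; exact: CrW.
by apply/funext => x; rewrite deriveM // -[X in X + _]scale1r.
Qed.

Lemma is_derive_coord i (x v : 'rV[R]_m) :
  is_derive x v (fun y : 'rV[R]_m => y 0 i) (v 0 i).
Proof.
have @h : {linear 'rV[R]_m -> R}.
  by exists (fun y : 'rV[R]_m => y 0 i); do 2![eexists]; do ?[constructor];
     rewrite ?mxE// => ? *; rewrite ?mxE//; move=> ?; rewrite !mxE.
have ch : continuous h by move=> y; exact: coord_continuous.
have dh : differentiable h x by exact: linear_differentiable.
rewrite (_ : (fun _ => _) = h) //.
by apply: DeriveDef; [exact: diff_derivable | rewrite deriveE // diff_lin].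
Qed.

Lemma Cr_coord r i : Cr r (fun x : 'rV[R]_m => x 0 i).
Proof.
have cc : continuous (fun x : 'rV[R]_m => x 0 i).
  by move=> x; exact: coord_continuous.
case: r => [|r]; first by split.
split=> // j; have D x := is_derive_coord i x (unit_vec j).
split=> [x|]; first by have [] := D x.
rewrite (_ : (fun x => _) = fun=> unit_vec j 0 i); first exact: Cr_cst.
by apply/funext => x; have [] := D x.
Qed.

Definition smooth_pred : {pred 'rV[R]_m -> R} := [pred f | `[< smooth f >]].

Lemma smooth_submod_closed : submod_closed smooth_pred.
Proof.
split=> [|c f g]; rewrite !inE.
  by move=> r; exact: Cr_cst.
by move=> Hf Hg r; apply: Cr_linear; [exact: Hf | exact: Hg].
Qed.

Lemma smooth_subring_closed : subring_closed smooth_pred.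
Proof.
split=> [|f g|f g]; rewrite !inE.
- by move=> r; exact: Cr_cst.
- move=> Hf Hg r.
  have -> : f - g = (fun x => -1 * g x + f x).
    by apply/funext => x; rewrite mulN1r addrC.
  by apply: Cr_linear; [exact: Hg | exact: Hf].
- by move=> Hf Hg r; apply: Cr_mul; [exact: Hf | exact: Hg].
Qed.

HB.instance Definition _ :=
  GRing.isSubringClosed.Build _ smooth_pred smooth_subring_closed.
HB.instance Definition _ :=
  GRing.isSubmodClosed.Build R _ smooth_pred smooth_submod_closed.

Record smooth_fun :=
  SmoothFun { smooth_val :> 'rV[R]_m -> R; _ : smooth_val \in smooth_pred }.

HB.instance Definition _ := [isSub for smooth_val].
HB.instance Definition _ := [Choice of smooth_fun by <:].
HB.instance Definition _ := [SubChoice_isSubComNzRing of smooth_fun by <:].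
HB.instance Definition _ := [SubZmodule_isSubLmodule of smooth_fun by <:].

Lemma coord_smooth i : (fun x : 'rV[R]_m => x 0 i) \in smooth_pred.
Proof. by rewrite inE => r; exact: Cr_coord. Qed.

Definition coord i : smooth_fun := SmoothFun (coord_smooth i).

Lemma partial_smooth i (f : smooth_fun) :
  (fun x => 'D_(unit_vec i) f x) \in smooth_pred.
Proof.
case: f => f /=; rewrite !inE => Hf r.
by have [_ /(_ i) []] := Hf r.+1.
Qed.

Definition partial i (f : smooth_fun) : smooth_fun :=
  SmoothFun (partial_smooth i f).

End SmoothFunctions.

Arguments smooth_fun : clear implicits.

(* Coordinates on R^(2n+1) are ordered p_1, .., p_n, q^1, .., q^n, t; the same
   indices serve for the fibre coordinates. *)
Definition cdim (n : nat) : nat := (n + n + 1)%N.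

Section ContactGeometry.
Context {R : realType} {n : nat}.

Definition idx_p (j : 'I_n) : 'I_(cdim n) := lshift 1 (lshift n j).
Definition idx_q (j : 'I_n) : 'I_(cdim n) := lshift 1 (rshift n j).
Definition idx_t : 'I_(cdim n) := rshift (n + n) ord0.

Local Notation A := (smooth_fun R (cdim n)).
Local Notation vfield := 'rV[A]_(cdim n).
Local Notation tens := (mpoly (cdim n) A).

Definition cst_fun (c : R) : A := c *: (1 : A).

Definition vderive (Z : vfield) (f : A) : A := \sum_i Z 0 i * partial i f.

Definition dvec (i : 'I_(cdim n)) : vfield := delta_mx 0 i.

Definition euler_s : vfield :=
  \sum_(j < n) (coord (idx_p j) *: dvec (idx_p j)
              + coord (idx_q j) *: dvec (idx_q j)).

Definition contact_ham (h : A) : vfield :=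
  \sum_(j < n) (partial (idx_p j) h *: dvec (idx_q j)
              - partial (idx_q j) h *: dvec (idx_p j))
  + vderive euler_s h *: dvec idx_t
  - partial idx_t h *: euler_s
  - (2%:R * h) *: dvec idx_t.

Definition poly_fun (h : mpoly (cdim n) R) : A :=
  mmap cst_fun (fun i => coord i : A) h.

(* mmeasure mdeg h is 1 + deg h (and 0 for h = 0). *)
Definition sp_alg : set vfield :=
  [set Z | exists2 h : mpoly (cdim n) R,
     (mmeasure mdeg h <= 3)%N & Z = contact_ham (poly_fun h)].

(* A symmetric contravariant tensor field is a polynomial in the fibre
   coordinates xi over the ring of smooth functions.  The density bundles are
   trivialised by |dp dq dt|^delta, so the weight only shows in lie. *)
Local Notation xi i := (mpolyX A (mnm1 i)).
Local Notation dxi i := (@mderiv (cdim n) A i).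
Local Notation dx i := (@map_mpoly (cdim n) A A (partial i)).

Definition sym_tensor (k : nat) : set tens := [set S | S \is ishomog1 k mdeg].

Definition lie (delta : R) (Z : vfield) (P : tens) : tens :=
  map_mpoly (vderive Z) P
  - \sum_i \sum_j partial j (Z 0 i) *: (xi i * dxi j P)
  + (cst_fun delta * \sum_i partial i (Z 0 i)) *: P.

Definition i_alpha (S : tens) : tens :=
  cst_fun 2%:R^-1 *:
    (\sum_(j < n) (coord (idx_p j) *: dxi (idx_q j) S
                 - coord (idx_q j) *: dxi (idx_p j) S)
     - dxi idx_t S).

Definition gen_ham (delta : R) (k : nat) (S : tens) : tens :=
  \sum_(j < n) (xi (idx_q j) * dx (idx_p j) S - xi (idx_p j) * dx (idx_q j) S)
  + xi idx_t * map_mpoly (vderive euler_s) S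
  - (\sum_(j < n) (coord (idx_p j) *: xi (idx_p j)
                 + coord (idx_q j) *: xi (idx_q j))) * dx idx_t S
  + cst_fun (2%:R * n.+1%:R * delta + k%:R) *: (xi idx_t * S).

(* l successive applications of gen_ham, starting in degree j. *)
Fixpoint gen_ham_iter (delta : R) (j l : nat) (S : tens) : tens :=
  if l is l'.+1 then gen_ham delta (j + l') (gen_ham_iter delta j l' S) else S.

Definition Rkl (delta : R) (k l : nat) : set tens :=
  gen_ham_iter delta (k - l) l @`
    (sym_tensor (k - l) `&` [set S | i_alpha S = 0]).

Definition Rk_weight (delta : R) (k : nat) : R := delta + k%:R / n.+1%:R.

Definition sp_stable (w : R) (V : set tens) : Prop :=
  forall Z, sp_alg Z -> forall S, V S -> V (lie w Z S).

(* T : V -> V' is R-linear and intertwines the Lie derivatives of weights w and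
   w'; the values of T outside V are irrelevant when V is stable. *)
Definition sp_invariant (w w' : R) (V V' : set tens) (T : tens -> tens) :
    Prop :=
  [/\ forall S, V S -> V' (T S),
      forall c S1 S2, V S1 -> V S2 ->
        T (cst_fun c *: S1 + S2) = cst_fun c *: T S1 + T S2 &
      forall Z S, sp_alg Z -> V S -> T (lie w Z S) = lie w' Z (T S)].

End ContactGeometry.

Arguments sym_tensor {R} n k.
Arguments Rkl {R} n delta k l.
Arguments Rk_weight {R} n delta k.

Section Casimir.
Context {R : realType}.

Definition critical_set (n k : nat) : set R :=
  [set delta | exists2 p : nat,
     (p + 2 <= 2 * k)%N & delta = - (p%:R / (2%:R * n.+1%:R))].

Definition casimir_eig (n k l : nat) (delta : R) : R :=
  let N : R := n.+1%:R in
  (n + 2)%:R^-1 *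
  (N ^+ 2 * delta ^+ 2 - N ^+ 2 * delta + k%:R * N * delta
   + (k%:R ^+ 2 - k%:R) / 2%:R
   - l%:R / 2%:R * (2%:R * N * delta + 2%:R * k%:R - l%:R - 1)).

End Casimir.

Definition vanishes_on {R : realType} {n : nat}
    (V : set (mpoly (cdim n) (smooth_fun R (cdim n))))
    (T : mpoly (cdim n) (smooth_fun R (cdim n)) ->
         mpoly (cdim n) (smooth_fun R (cdim n))) : Prop :=
  forall S, V S -> T S = 0.

(* The restriction of T to R^{k,l}_delta is an invariant operator between
   sp-modules, into R^{k',l'}_delta', and the Casimir eigenvalues agree. *)
Definition component_map {R : realType} {n : nat} (k k' : nat)
    (delta delta' : R)
    (T : mpoly (cdim n) (smooth_fun R (cdim n)) ->
         mpoly (cdim n) (smooth_fun R (cdim n)))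
    (l l' : nat) : Prop :=
  [/\ sp_stable (Rk_weight n delta k) (Rkl n delta k l),
      sp_stable (Rk_weight n delta' k') (Rkl n delta' k' l'),
      sp_invariant (Rk_weight n delta k) (Rk_weight n delta' k')
        (Rkl n delta k l) (Rkl n delta' k' l') T &
      casimir_eig n k' l' delta' = casimir_eig n k l delta].

(* Main.v *)
From HB Require Import structures.
Require Import Defs.
From mathcomp Require Import all_boot all_order all_algebra.
From mathcomp Require Import all_classical all_reals all_analysis.
From mathcomp Require Import -(notations) mpoly.
From mathcomp Require Import ring lra zify.

(** [sp_(2n+2)] acts linearly on homogeneous coordinates [z_a] of projective
(2n+1)-space, and the contact fields of degree at most 2 are those of the
products [z_a z_b]. Writing [d_a] for the homogeneous derivatives, [zeta_a] for
the momenta and [V_a] for the fibre derivatives, such a field acts by the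
symplectic symmetrisation of the [gl]-generators [z_a d_b - zeta_b V_a]; with
the symplectic pairing of [z] with [V] being [2 i_alpha] and that of [zeta] with
[d] being [- X], both operators are visibly invariant, the Casimir operator
comes out as an affine function of [X i_alpha], and
[i_alpha X = X i_alpha - ((n + 1) delta + k)] on degree [k].

If [X i_alpha U = mu U] in degree [k], then [i_alpha U] is an eigenvector in
degree [k - 1]; for regular [delta] induction on [k] shows that [U] lies in one
of the [R^(k,l)]. As [T] commutes with the Casimir operator, it maps each
[R^(k,l)] to eigenvectors, hence into the unique [R^(k',l')] with the same
Casimir eigenvalue; regularity makes these eigenvalues distinct. *)

Set Implicit Arguments.
Unset Strict Implicit.
Unset Printing Implicit Defensive.

Import Order.TTheory GRing.Theory Num.Theory.
Import numFieldNormedType.Exports.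

(** * The symplectic algebra of homogeneous coordinates *)

(** A k-tensor field with values in w-densities becomes a function of degree - c in z, with c =
    (2n+2) w - k, on the hyperplane [\sum_a z a * zeta a = 0] of momenta. In the chart z_o = 1 that
    relation eliminates zeta_o and Euler's relation eliminates d_o. The operators d and V are the
    derivatives tangent to the hyperplane, which causes their extra commutators, and d_o depends on
    c. Hence i_alpha and X do not commute with one fixed family of operators: they intertwine the
    families of degrees c and c + 1. The weight delta + k/(n+1) makes c equal to 2(n+1) delta + k,
    which moves in step with k. The eigenvalue of X i_alpha on R^(k,l) is minus the sum of the
    commutator constants (n+1) delta + i for k - l <= i < k. For l and l' distinct, two such
    eigenvalues agree exactly when delta = - (2k-1-l-l') / (2(n+1)); as l and l' vary, these are the
    values in C_k. *)

Section HomogeneousFrame.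
Local Open Scope ring_scope.
Variables (K : comNzRingType) (I : finType) (o : I) (dual : I -> I).
Variables (sg : I -> bool) (z zeta : I -> K) (c : K).
Variables d V : I -> {additive K -> K}.

Local Notation "a ^*" := (dual a) : ring_scope.
Local Notation s a := ((-1) ^+ sg a : K).

(* The terms in (a == o) come from restricting functions homogeneous of degree
   - c to the chart z_o = 1, where Euler's relation expresses d o. *)
Record homogeneous_frame : Prop := HomogeneousFrame {
  hframe_dualK : involutive dual;
  hframe_sg_dual : forall a, sg a^* = ~~ sg a;
  hframe_z_o : z o = 1;
  hframe_V_o : forall F, V o F = 0;
  hframe_d_z : forall a b F,
    d a (z b * F) = z b * d a F + (a == b)%:R * F - (a == o)%:R * (z b * F);
  hframe_d_zeta : forall a b F,
    d a (zeta b * F) = zeta b * d a F - (b == o)%:R * (zeta a * F);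
  hframe_V_z : forall a b F, V a (z b * F) = z b * V a F;
  hframe_V_zeta : forall a b F,
    V a (zeta b * F)
    = zeta b * V a F + (a == b)%:R * F - (b == o)%:R * (z a * F);
  hframe_dV : forall a b F, d a (V b F) = V b (d a F);
  hframe_VV : forall a b F, V a (V b F) = V b (V a F);
  hframe_dd : forall a b F,
    d a (d b F) = d b (d a F) + (a == o)%:R * d b F - (b == o)%:R * d a F;
  hframe_sum_z_zeta : \sum_a z a * zeta a = 0;
  hframe_sum_z_d : forall F, \sum_a z a * d a F = - (c * F)
}.

Hypothesis frame : homogeneous_frame.
Let dualK := hframe_dualK frame.
Let sg_dual := hframe_sg_dual frame.
Let z_o := hframe_z_o frame.
Let V_o := hframe_V_o frame.
Let d_z := hframe_d_z frame.
Let d_zeta := hframe_d_zeta frame.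
Let V_z := hframe_V_z frame.
Let V_zeta := hframe_V_zeta frame.
Let dV := hframe_dV frame.
Let VV := hframe_VV frame.
Let dd := hframe_dd frame.
Let sum_z_zeta := hframe_sum_z_zeta frame.
Let sum_z_d := hframe_sum_z_d frame.

Definition gl_op a b F := z a * d b F - zeta b * V a F.
Definition sp_op a b F := s b * gl_op a b^* F + s a * gl_op b a^* F.
Definition fiber_euler F := \sum_a zeta a * V a F.
(* For the contact structure these two are 2 i_alpha and - X. *)
Definition contact_contr F := \sum_a s a * (z a * V a^* F).
Definition contact_op F := \sum_a s a * (zeta a * d a^* F).
(** Multiplication by this element is what [contact_op] gains when the degree c grows by one
    ([contact_opS]). *)
Definition frame_w0 := s o * zeta o^*.
Local Notation w0 := frame_w0.

Local Notation E := gl_op.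
Local Notation L := sp_op.
Local Notation J := contact_contr.
Local Notation Y := contact_op.
Local Notation e := fiber_euler.

Lemma sum_delta (b : I) (G : I -> K) : \sum_a (a == b)%:R * G a = G b.
Proof.
rewrite (bigD1 b) //= eqxx mul1r big1 ?addr0 // => a /negPf ->.
by rewrite mul0r.
Qed.

Lemma sum_cst (x : K) : \sum_(a : I) x = #|I|%:R * x.
Proof. by rewrite sumr_const mulr_natl. Qed.

Lemma sum_dual (G : I -> K) : \sum_a G a = \sum_a G a^*.
Proof. by rewrite (reindex_inj (inv_inj dualK)). Qed.

Lemma s_dual a : s a^* = - s a.
Proof. by rewrite sg_dual signrN. Qed.

Lemma s_sqr a : s a * s a = 1.
Proof. by rewrite -expr2 sqrr_sign. Qed.

Lemma dual_eq a b : (a^* == b) = (a == b^*).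
Proof. by rewrite -(inj_eq (inv_inj dualK)) dualK. Qed.

Lemma fS (f : {additive K -> K}) a F : f (s a * F) = s a * f F.
Proof. exact: raddfMsign. Qed.

(* A sum that changes sign under a -> a^* vanishes, even in characteristic 2,
   because the involution pairs the indices with sg a and ~~ sg a. *)
Lemma sum_antisym (G : I -> K) : (forall a, G a^* = G a) ->
  \sum_a s a * G a = 0.
Proof.
move=> G_dual; rewrite (bigID sg) /=.
rewrite [X in _ + X](reindex_inj (inv_inj dualK)) /=.
under [X in _ + X]eq_bigl => a do rewrite sg_dual negbK.
rewrite -big_split big1 // => a _; rewrite /= G_dual s_dual; ring.
Qed.

Lemma JM_z a F : J (z a * F) = z a * J F.
Proof.
rewrite /J mulr_sumr; apply: eq_bigr => b _; rewrite V_z; ring.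
Qed.

Lemma JV a F : J (V a F) = V a (J F).
Proof.
rewrite raddf_sum; apply: eq_bigr => b _ /=.
by rewrite fS V_z VV.
Qed.

(** Eliminating zeta_o adds a sum of [s a * (z a * z a^* * _)], which cancels by antisymmetry; only
    the canonical commutator remains. *)
Lemma JM_zeta b F : J (zeta b * F) = zeta b * J F - s b * (z b^* * F).
Proof.
have -> : J (zeta b * F) = \sum_a (zeta b * (s a * (z a * V a^* F)))
    + \sum_a (a == b^*)%:R * (s a * z a * F)
    - \sum_a s a * (z a * z a^* * ((b == o)%:R * F)).
  rewrite -big_split -sumrB; apply: eq_bigr => a _ /=.
  rewrite V_zeta dual_eq; ring.
rewrite -mulr_sumr -/(J F) sum_delta [X in _ - X]sum_antisym; last first.
  by move=> a; rewrite /= dualK; ring.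
rewrite s_dual; ring.
Qed.

Lemma J_d b F : J (d b F) = d b (J F) - s b * V b^* F + (b == o)%:R * J F.
Proof.
have -> : d b (J F) = J (d b F) + \sum_a (a == b)%:R * (s a * V a^* F)
   - (b == o)%:R * J F.
  rewrite /J raddf_sum mulr_sumr -big_split -sumrB; apply: eq_bigr => a _ /=.
  rewrite fS d_z dV [b == a]eq_sym; ring.
rewrite sum_delta; ring.
Qed.

Lemma YM_z a F :
  Y (z a * F) = z a * Y F - s a * (zeta a^* * F) + w0 * (z a * F).
Proof.
have -> : Y (z a * F) = z a * Y F
    + \sum_b (b == a^*)%:R * (s b * zeta b * F)
    - \sum_b (b == o^*)%:R * (s b * zeta b * (z a * F)).
  rewrite /Y mulr_sumr -big_split -sumrB; apply: eq_bigr => b _ /=.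
  rewrite d_z !dual_eq; ring.
rewrite !sum_delta /frame_w0 !s_dual; ring.
Qed.

Lemma YM_zeta b F : Y (zeta b * F) = zeta b * Y F.
Proof.
have -> : Y (zeta b * F) = zeta b * Y F
    - \sum_a s a * (zeta a * zeta a^* * ((b == o)%:R * F)).
  rewrite /Y mulr_sumr -sumrB; apply: eq_bigr => a _ /=.
  rewrite d_zeta; ring.
rewrite [X in _ - X]sum_antisym ?subr0 // => a; rewrite /= dualK; ring.
Qed.

Lemma Y_d b F :
  Y (d b F) = d b (Y F) - (b == o)%:R * Y F - w0 * d b F
              + s o * (zeta b * d o^* F).
Proof.
have -> : d b (Y F) = Y (d b F) + (b == o)%:R * Y F
    - \sum_a (a == o^*)%:R * (s a * zeta a * d b F)
    - \sum_a (a == o)%:R * (s a * zeta b * d a^* F).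
  rewrite /Y raddf_sum mulr_sumr -big_split -!sumrB.
  apply: eq_bigr => a _ /=; rewrite fS d_zeta (dd b) dual_eq; ring.
rewrite !sum_delta s_dual /frame_w0; ring.
Qed.

Lemma Y_V b F :
  Y (V b F) = V b (Y F) - s b * d b^* F + s o * (z b * d o^* F).
Proof.
have -> : V b (Y F) = Y (V b F) + \sum_a (a == b)%:R * (s a * d a^* F)
    - \sum_a (a == o)%:R * (s a * z b * d a^* F).
  rewrite /Y raddf_sum -big_split -sumrB; apply: eq_bigr => a _ /=.
  rewrite fS V_zeta dV [b == a]eq_sym; ring.
rewrite !sum_delta; ring.
Qed.

Lemma JB F G : J (F - G) = J F - J G.
Proof.
by rewrite /J -sumrB; apply: eq_bigr => a _; rewrite raddfB /=; ring.
Qed.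

Lemma YB F G : Y (F - G) = Y F - Y G.
Proof.
by rewrite /Y -sumrB; apply: eq_bigr => a _; rewrite raddfB /=; ring.
Qed.

Lemma JD F G : J (F + G) = J F + J G.
Proof.
by rewrite /J -big_split; apply: eq_bigr => a _; rewrite raddfD /=; ring.
Qed.

Lemma YD F G : Y (F + G) = Y F + Y G.
Proof.
by rewrite /Y -big_split; apply: eq_bigr => a _; rewrite raddfD /=; ring.
Qed.

Lemma J0 : J 0 = 0.
Proof. by rewrite /J big1 // => a _; rewrite raddf0 !mulr0. Qed.

Lemma Y0 : Y 0 = 0.
Proof. by rewrite /Y big1 // => a _; rewrite raddf0 !mulr0. Qed.

Lemma JS a F : J (s a * F) = s a * J F.
Proof. by rewrite /J mulr_sumr; apply: eq_bigr => b _; rewrite fS; ring. Qed.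

Lemma YS a F : Y (s a * F) = s a * Y F.
Proof. by rewrite /Y mulr_sumr; apply: eq_bigr => b _; rewrite fS; ring. Qed.

(** The coefficient of [d o] in [sp_op a b]. Raising c by one subtracts it from [sp_op] ([sp_opS]),
    so the two defects below express that J lowers c by one and Y raises it. *)
Definition sp_shift a b : K := s b * ((b^* == o)%:R * z a)
                             + s a * ((a^* == o)%:R * z b).

Lemma contact_contr_sp a b F : J (L a b F) = L a b (J F) + sp_shift a b * J F.
Proof.
rewrite /L /E JD !JS !JB !JM_z !JM_zeta !J_d !JV !dualK /sp_shift.
rewrite !s_dual; ring: (s_sqr a) (s_sqr b).
Qed.

Lemma contact_op_sp a b F : Y (L a b F) = L a b (Y F) - sp_shift a b * Y F.
Proof.
rewrite /L /E YD !YS !YB !YM_z !YM_zeta !Y_d !Y_V /sp_shift; ring.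
Qed.

(** The sl_2-type commutator of the two operators: [e F] collects the [zeta b * V b F], and [c * F]
    comes from Euler's relation. The [w0] term turns Y into the operator of degree c - 1. *)
Lemma contact_contr_op F :
  J (Y F) = Y (J F) - w0 * J F + e F + c * F.
Proof.
pose G b := s b * (zeta b * d b^* (J F)) + zeta b * V b F
  + (b == o^*)%:R * (s b * (zeta b * J F)) - z b^* * d b^* F.
have -> : J (Y F) = \sum_b G b.
  rewrite {1}/Y (big_morph J JD J0).
  apply: eq_bigr => b _; rewrite JS JM_zeta J_d !dualK dual_eq s_dual /G.
  ring: (s_sqr b).
rewrite /G sumrB !big_split /= sum_delta.
rewrite -(sum_dual (fun b => z b * d b F)) sum_z_d s_dual /frame_w0 /Y /e; ring.
Qed.

Lemma gl_opD a b F G : E a b (F + G) = E a b F + E a b G.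
Proof. by rewrite /E !raddfD /=; ring. Qed.

Lemma gl_opS a b a' F : E a b (s a' * F) = s a' * E a b F.
Proof. by rewrite /E !fS /=; ring. Qed.

(** For the invariant form that the symplectic form induces on quadratic polynomials, the basis dual
    to the products z_a z_b consists, up to normalisation, of the products of dual coordinates with
    sign [s a * s b]. *)
Definition casimir_op F := \sum_a \sum_b s a * s b * L a b (L a^* b^* F).

(** Four double sums appear, equal in pairs after reindexing by duality. The first kind is the
    Casimir operator of gl, a scalar in fixed degrees; the twisted kind carries the dependence on Y
    J. *)
Lemma casimir_gl F : casimir_op F =
  - (2%:R * (\sum_a \sum_b E a b (E b a F)
             - \sum_a \sum_b s a * s b * E a b (E a^* b^* F))).
Proof.
pose P a b := E a b (E b a F).
pose Q a b := s a * s b * E a b (E a^* b^* F).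
have -> : casimir_op F = \sum_a \sum_b (Q a b^* - P a b^* - P b a^* + Q b a^*).
  apply: eq_bigr => a _; apply: eq_bigr => b _.
  rewrite /L 2!gl_opD 4!gl_opS /P /Q !dualK !s_dual.
  ring: (s_sqr a) (s_sqr b).
have sum2 G : \sum_a \sum_b G a b^* = \sum_a \sum_b G a b :> K.
  by apply: eq_bigr => a _; rewrite -sum_dual.
have sum2' G : \sum_a \sum_b G b a^* = \sum_a \sum_b G a b :> K.
  by rewrite exchange_big /=; exact: sum2.
under eq_bigr do rewrite big_split sumrB sumrB.
rewrite big_split sumrB sumrB /= !sum2 !sum2' -/P -/Q; ring.
Qed.

Lemma euler_V b F : e (V b F) = V b (e F) - V b F.
Proof.
have -> : V b (e F) = e (V b F) + \sum_a (a == b)%:R * V a F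
    - \sum_a (a == o)%:R * (z b * V a F).
  rewrite /e raddf_sum -big_split -sumrB; apply: eq_bigr => a _ /=.
  by rewrite V_zeta VV [b == a]eq_sym; ring.
rewrite !sum_delta V_o; ring.
Qed.

(** The degrees - c in z and k in zeta determine everything: each term reduces by one of the two
    Euler relations or contains the factor [\sum_a z a * zeta a = 0]. *)
Lemma sum_gl_op F k : e F = k%:R * F ->
  \sum_a \sum_b E a b (E b a F)
  = (c * (c + 1 - #|I|%:R) + k%:R * (k%:R - 1 + #|I|%:R)) * F.
Proof.
move=> eF.
have eV b : e (V b F) = (k%:R - 1) * V b F.
  by rewrite euler_V eF mulr_natl raddfMn -mulr_natl; ring.
have inner a : \sum_b E a b (E b a F) =
    (#|I|%:R - 1 - c) * (z a * d a F) - z a * zeta a * (\sum_b d b (V b F))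
    + (k%:R - 1) * (zeta a * V a F) + k%:R * F.
  have -> : \sum_b E a b (E b a F) =
      z a * (\sum_b z b * d b (d a F)) + \sum_(b : I) z a * d a F
      - \sum_b (b == o)%:R * (z a * z b * d a F)
      - z a * zeta a * (\sum_b d b (V b F))
      - (\sum_b z b * zeta b) * V a (d a F)
      + zeta a * e (V a F) + e F.
    rewrite /e !mulr_sumr mulr_suml -big_split -!sumrB -!big_split /=.
    apply: eq_bigr => b _.
    rewrite /E !raddfB /= d_z d_zeta V_z V_zeta !eqxx (VV a b) /=; ring.
  rewrite sum_z_d sum_cst sum_delta z_o sum_z_zeta eV eF; ring.
under eq_bigr do rewrite inner.
rewrite 2!big_split sumrB -!mulr_sumr -mulr_suml sum_z_zeta sum_z_d sum_cst.
rewrite -/(e F) eF /=; ring.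
Qed.

(** Terms with two z's or two zeta's contain an antisymmetric sum and vanish. The mixed terms form
    [S1] and [S2], which are Y J with one of the two operators moved across a letter. *)
Lemma sum_twisted_gl_op F k : e F = k%:R * F ->
  \sum_a \sum_b s a * s b * E a b (E a^* b^* F)
  = c * F + k%:R * F + 2%:R * (Y (J F) - w0 * J F).
Proof.
move=> eF.
pose S1 := \sum_b s b * (zeta b * J (d b^* F)).
have S1E : S1 = Y (J F) + e F - w0 * J F.
  have -> : S1 = Y (J F) + e F + \sum_b (b == o^*)%:R * (s b * (zeta b * J F)).
    rewrite /S1 /Y /e -!big_split; apply: eq_bigr => b _ /=.
    rewrite J_d dualK dual_eq s_dual; ring: (s_sqr b).
  rewrite sum_delta s_dual /frame_w0; ring.
pose S2 := \sum_a s a * (z a * Y (V a^* F)).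
have S2E : S2 = Y (J F) + e F - w0 * J F.
  have -> : Y (J F) = \sum_a Y (s a * (z a * V a^* F)).
    exact: (big_morph Y YD Y0).
  have -> : e F = \sum_a zeta a^* * V a^* F by rewrite /e sum_dual.
  rewrite /S2 /J mulr_sumr -big_split -sumrB; apply: eq_bigr => a _ /=.
  rewrite YS YM_z; ring: (s_sqr a).
have inner a : \sum_b s a * s b * E a b (E a^* b^* F) =
    s a * (z a * z a^* * (\sum_b s b * d b (d b^* F)))
    - z a * d a F
    - s a * (z a * z a^* * (s o * d o^* F))
    + s a * (z a * Y (V a^* F))
    + s a^* * (z a^* * (\sum_b s b * (zeta b * V a (d b^* F))))
    - zeta a^* * V a^* F
    + (\sum_b s b * (zeta b * zeta b^*)) * (s a * V a (V a^* F)).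
  have -> : z a * d a F = \sum_b (b == a^*)%:R * (z a * d b^* F).
    by rewrite sum_delta dualK.
  have -> : s a * (z a * z a^* * (s o * d o^* F)) =
      \sum_b (b == o)%:R * (s a * (z a * z a^* * (s b * d b^* F))).
    by rewrite sum_delta.
  have -> : s a * (z a * Y (V a^* F)) =
      - \sum_b s a * (z a * (s b * (zeta b^* * d b (V a^* F)))).
    rewrite /Y sum_dual !mulr_sumr -sumrN; apply: eq_bigr => b _.
    by rewrite s_dual dualK; ring.
  have -> : zeta a^* * V a^* F = \sum_b (b == a^*)%:R * (zeta b * V a^* F).
    by rewrite sum_delta.
  rewrite [s a^* * _]mulrA !mulr_sumr mulr_suml.
  rewrite !(=^~ sumrN, =^~ sumrB, =^~ big_split) /=.
  apply: eq_bigr => b _.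
  rewrite /E !raddfB /= d_z d_zeta V_z V_zeta !dual_eq [a == b^*]eq_sym dual_eq.
  have [->|_] := eqVneq b a^*; rewrite ?dualK ?s_dual /=; ring: (s_sqr a).
have zz X : \sum_a s a * (z a * z a^* * X) = 0.
  by rewrite sum_antisym // => a; rewrite dualK; ring.
have zetazeta : \sum_b s b * (zeta b * zeta b^*) = 0.
  by rewrite sum_antisym // => a; rewrite dualK; ring.
have S1E' : \sum_a s a^* * (z a^* * \sum_b s b * (zeta b * V a (d b^* F))) = S1.
  rewrite /S1 /J; under [RHS]eq_bigr do rewrite sum_dual !mulr_sumr.
  rewrite [RHS]exchange_big; apply: eq_bigr => a _.
  rewrite !mulr_sumr; apply: eq_bigr => b _; rewrite dualK; ring.
under eq_bigr do rewrite inner zetazeta mul0r addr0.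
rewrite !(sumrB, big_split) /= !zz sum_z_d S1E' -/S2.
rewrite -(sum_dual (fun a => zeta a * V a F)) -/(e F) S1E S2E eF; ring.
Qed.

Lemma casimir_opE F k : e F = k%:R * F ->
  casimir_op F
  = - (2%:R * (c * (c - #|I|%:R) + k%:R * (k%:R - 2%:R + #|I|%:R)) * F)
    + 4%:R * (Y (J F) - w0 * J F).
Proof.
by move=> eF; rewrite casimir_gl (sum_gl_op eF) (sum_twisted_gl_op eF); ring.
Qed.

End HomogeneousFrame.

(** * The homogeneous operators in an affine chart *)

Section CoordinateFrame.
Local Open Scope ring_scope.
Variables (K : comNzRingType) (N : finType) (x xi : N -> K).
Variables D Dxi : N -> {additive K -> K}.
Local Notation I := (option N).

Record phase_coordinates : Prop := PhaseCoordinates {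
  phase_DM : forall i F G, D i (F * G) = F * D i G + D i F * G;
  phase_DxiM : forall i F G, Dxi i (F * G) = Dxi i F * G + F * Dxi i G;
  phase_Dx : forall i j, D i (x j) = (i == j)%:R;
  phase_D_xi : forall i j, D i (xi j) = 0;
  phase_Dxix : forall i j, Dxi i (x j) = 0;
  phase_Dxixi : forall i j, Dxi i (xi j) = (i == j)%:R;
  phase_DC : forall i j F, D i (D j F) = D j (D i F);
  phase_DxiC : forall i j F, Dxi i (Dxi j F) = Dxi j (Dxi i F);
  phase_DDxi : forall i j F, D i (Dxi j F) = Dxi j (D i F)
}.

Definition hom_z (a : I) : K := if a is Some i then x i else 1.
(** The values at [None] are forced: the momentum by the hyperplane relation, the derivative by
    Euler's relation in degree - c. The fibre derivative is zero because each fibre derivative in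
    direction a is corrected by - z_a times the one in direction [None] to be tangent to the
    hyperplane. *)
Definition hom_zeta (a : I) : K :=
  if a is Some i then xi i else - \sum_i x i * xi i.
Definition hom_d (c : K) (a : I) (F : K) : K :=
  if a is Some i then D i F else - (\sum_i x i * D i F) - c * F.
Definition hom_V (a : I) (F : K) : K := if a is Some i then Dxi i F else 0.

Lemma hom_d_is_zmod_morphism c a : zmod_morphism (hom_d c a).
Proof.
case: a => [i|] F G; rewrite /hom_d ?raddfB //.
under eq_bigr do rewrite raddfB mulrBr.
rewrite sumrB /=; ring.
Qed.

Lemma hom_V_is_zmod_morphism a : zmod_morphism (hom_V a).
Proof. by case: a => [i|] F G; rewrite /hom_V ?subr0 // raddfB. Qed.

HB.instance Definition _ c a :=
  GRing.isZmodMorphism.Build K K (hom_d c a) (hom_d_is_zmod_morphism c a).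
HB.instance Definition _ a :=
  GRing.isZmodMorphism.Build K K (hom_V a) (hom_V_is_zmod_morphism a).

Lemma sum_option (V : nmodType) (F : I -> V) :
  \sum_a F a = F None + \sum_i F (Some i).
Proof.
rewrite (bigD1 None) //=; congr (_ + _).
rewrite (reindex_omap Some id) => [|[i|] //]; apply: eq_bigl => i.
by rewrite eqxx.
Qed.

Lemma hom_euler F : fiber_euler hom_zeta hom_V F = \sum_i xi i * Dxi i F.
Proof. by rewrite /fiber_euler sum_option /= mulr0 add0r. Qed.

Variables (dual : I -> I) (sg : I -> bool) (c : K).
Hypothesis dualK : involutive dual.
Hypothesis sg_dual : forall a, sg (dual a) = ~~ sg a.
Hypothesis phase : phase_coordinates.
Hypothesis Dc : forall i F, D i (c * F) = c * D i F.
Hypothesis Dxic : forall i F, Dxi i (c * F) = c * Dxi i F.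

Let DM := phase_DM phase.
Let DxiM := phase_DxiM phase.
Let Dx := phase_Dx phase.
Let D_xi := phase_D_xi phase.
Let Dxix := phase_Dxix phase.
Let Dxixi := phase_Dxixi phase.
Let DC := phase_DC phase.
Let DxiC := phase_DxiC phase.
Let DDxi := phase_DDxi phase.

Lemma hom_frame :
  homogeneous_frame None dual sg hom_z hom_zeta c (hom_d c) hom_V.
Proof.
have eS i j : (Some i == Some j) = (i == j) by [].
split=> //.
- case=> [i|] [j|] F /=; rewrite ?eS ?eqxx /=.
  + by rewrite DM Dx; ring.
  + by rewrite mul1r; ring.
  + have -> : \sum_i x i * D i (x j * F) = x j * (\sum_i x i * D i F)
        + \sum_i (i == j)%:R * (x i * F).
      rewrite mulr_sumr -big_split; apply: eq_bigr => i _ /=.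
      by rewrite DM Dx; ring.
    by rewrite sum_delta; ring.
  + by rewrite !mul1r; ring.
- case=> [i|] [j|] F /=.
  + by rewrite DM D_xi; ring.
  + have -> : D i ((- \sum_j x j * xi j) * F)
        = - (\sum_j x j * xi j) * D i F - \sum_j (j == i)%:R * (xi j * F).
      rewrite DM raddfN (raddf_sum (D i)); congr (_ + _).
      rewrite mulNr mulr_suml; congr (- _); apply: eq_bigr => j _ /=.
      by rewrite DM D_xi Dx eq_sym; ring.
    by rewrite sum_delta; ring.
  + have -> : \sum_i x i * D i (xi j * F) = xi j * (\sum_i x i * D i F).
      rewrite mulr_sumr; apply: eq_bigr => i _ /=.
      by rewrite DM D_xi; ring.
    by ring.
  + pose e := \sum_j x j * xi j; rewrite -/e.
    (* The Euler field fixes [e], which is linear in the base coordinates. *)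
    have De : \sum_i x i * D i e = e.
      have -> : \sum_i x i * D i e = \sum_i \sum_j (j == i)%:R * (x i * xi j).
        apply: eq_bigr => i _; rewrite raddf_sum mulr_sumr.
        by apply: eq_bigr => j _; rewrite /= DM D_xi Dx eq_sym; ring.
      by apply: eq_bigr => i _; rewrite sum_delta.
    have -> : \sum_i x i * D i (- e * F)
        = - e * (\sum_i x i * D i F) - F * \sum_i x i * D i e.
      rewrite !mulr_sumr -sumrB; apply: eq_bigr => i _ /=.
      by rewrite DM raddfN; ring.
    by rewrite De; ring.
- case=> [i|] [j|] F /=; rewrite ?mulr0 ?mul1r //.
  by rewrite DxiM Dxix; ring.
- case=> [i|] [j|] F /=; rewrite ?eS ?eqxx /=.
  + by rewrite DxiM Dxixi; ring.
  + have -> : Dxi i ((- \sum_j x j * xi j) * F)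
        = - (\sum_j x j * xi j) * Dxi i F - \sum_j (j == i)%:R * (x j * F).
      rewrite DxiM raddfN (raddf_sum (Dxi i)) addrC; congr (_ + _).
      rewrite mulNr mulr_suml; congr (- _); apply: eq_bigr => j _ /=.
      by rewrite DxiM Dxix Dxixi eq_sym; ring.
    by rewrite sum_delta; ring.
  + by ring.
  + by ring.
- case=> [i|] [j|] F /=; rewrite ?raddf0 ?DDxi //.
    rewrite raddfB raddfN (raddf_sum (Dxi j)) Dxic.
    congr (- _ - _); apply: eq_bigr => i _ /=.
    by rewrite DxiM Dxix DDxi; ring.
  rewrite big1 => [|i _]; first by ring.
  by rewrite raddf0 mulr0.
- by case=> [i|] [j|] F /=; rewrite ?raddf0.
- have comm i F : D i (- (\sum_j x j * D j F) - c * F)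
      = - (\sum_j x j * D j (D i F)) - c * D i F - D i F.
    rewrite raddfB raddfN (raddf_sum (D i)) Dc.
    have -> : \sum_j D i (x j * D j F) = \sum_j x j * D j (D i F)
         + \sum_j (j == i)%:R * D j F.
      rewrite -big_split; apply: eq_bigr => j _ /=.
      by rewrite DM Dx DC eq_sym; ring.
    by rewrite sum_delta; ring.
  case=> [i|] [j|] F /=; rewrite ?eqxx /= ?comm.
  + by rewrite DC; ring.
  + by ring.
  + by ring.
  + by ring.
- by rewrite sum_option /= mul1r addNr.
- move=> F; rewrite sum_option /=; ring.
Qed.

Local Notation s a := ((-1) ^+ sg a : K).

Definition hom_lie (w : K) (Z : N -> K) (F : K) : K :=
  \sum_i Z i * D i F - \sum_i \sum_j D j (Z i) * (xi i * Dxi j F)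
  + w * (\sum_i D i (Z i)) * F.

(** The components in the chart of [s b] times the homogeneous derivative in the direction dual to
    b, the Hamiltonian field of z_b. The Leibniz rule then gives [quadratic_field] for z_a z_b. *)
Definition hom_field (b : I) (i : N) : K :=
  s b * ((dual b == Some i)%:R - (dual b == None)%:R * x i).

Definition quadratic_field (a b : I) (i : N) : K :=
  hom_z a * hom_field b i + hom_z b * hom_field a i.

Lemma D_sign a i F : D i (s a * F) = s a * D i F.
Proof. exact: raddfMsign. Qed.

Lemma D1 i : D i 1 = 0.
Proof.
have := DM i 1 1; rewrite !mulr1 mul1r => /eqP; rewrite -subr_eq0 opprD.
by rewrite addrA subrr sub0r oppr_eq0 => /eqP.
Qed.

Lemma D_field b i j :
  D j (hom_field b i) = - (s b * ((dual b == None)%:R * (j == i)%:R)).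
Proof.
rewrite /hom_field D_sign raddfB.
by case: (dual b == Some i); case: (dual b == None) => /=;
  rewrite ?mul0r ?mul1r ?raddf0 ?D1 ?Dx; ring.
Qed.

Lemma D_hom_z a i : D i (hom_z a) = (a == Some i)%:R.
Proof. by case: a => [j|] /=; [rewrite Dx eq_sym | exact: D1]. Qed.

Lemma sum_some (a : I) (G : N -> K) :
  \sum_i (a == Some i)%:R * G i = if a is Some i then G i else 0.
Proof.
case: a => [j|]; last by rewrite big1 // => i _; rewrite mul0r.
rewrite -[RHS]sum_delta; apply: eq_bigr => i _.
by rewrite [Some j == _]eq_sym.
Qed.

Lemma sum_field b (G : N -> K) : \sum_i hom_field b i * G i
  = s b * ((if dual b is Some i then G i else 0)
           - (dual b == None)%:R * \sum_i x i * G i).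
Proof.
rewrite -sum_some !mulr_sumr -sumrB mulr_sumr; apply: eq_bigr => i _.
by rewrite /hom_field; ring.
Qed.

Lemma sum_field_d b F : \sum_i hom_field b i * D i F
  = s b * (hom_d c (dual b) F + (dual b == None)%:R * (c * F)).
Proof. by rewrite sum_field; case: (dual b) => [i|] /=; ring. Qed.

Lemma sum_field_xi b : \sum_i hom_field b i * xi i = s b * hom_zeta (dual b).
Proof. by rewrite sum_field; case: (dual b) => [i|] /=; ring. Qed.

Lemma sum_hom_z_Dxi a F : \sum_i D i (hom_z a) * Dxi i F = hom_V a F.
Proof. by under eq_bigr do rewrite D_hom_z; rewrite sum_some. Qed.

Lemma sum_hom_z_field a b : \sum_i D i (hom_z a) * hom_field b i
  = s b * ((dual b == a)%:R - (dual b == None)%:R * hom_z a).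
Proof.
under eq_bigr do rewrite D_hom_z.
by rewrite sum_some; case: a => [i|]; rewrite /hom_field //=; ring.
Qed.

(** A w-density on a space of dimension #|N| has degree - w (#|N| + 1) in homogeneous coordinates,
    and k vectors add k; the condition says that the total degree is - c. *)
Lemma hom_lieE w k a b F : fiber_euler hom_zeta hom_V F = k * F ->
  c + k = w * (#|N|%:R + 1) ->
  hom_lie w (quadratic_field a b) F
  = sp_op dual sg hom_z hom_zeta (hom_d c) hom_V a b F.
Proof.
rewrite hom_euler => eF /(canRL (addrK _)) cE.
(* Each of the two products in the quadratic field acts as a gl-generator plus a trace term from the
   divergence. The trace terms cancel in the symmetrisation, as symplectic matrices are
   traceless. *)
have half a' b' : \sum_i hom_z a' * hom_field b' i * D i F
    - \sum_i \sum_j D j (hom_z a' * hom_field b' i) * (xi i * Dxi j F)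
    + w * (\sum_i D i (hom_z a' * hom_field b' i)) * F
    = s b' * gl_op hom_z hom_zeta (hom_d c) hom_V a' (dual b') F
      + w * F * (s b' * (dual b' == a')%:R).
  have -> : \sum_i hom_z a' * hom_field b' i * D i F
      = hom_z a' * \sum_i hom_field b' i * D i F.
    by rewrite mulr_sumr; apply: eq_bigr => i _; ring.
  have -> : \sum_i \sum_j D j (hom_z a' * hom_field b' i) * (xi i * Dxi j F)
      = (\sum_i hom_field b' i * xi i) * (\sum_i D i (hom_z a') * Dxi i F)
        - s b' * ((dual b' == None)%:R * hom_z a') * \sum_i xi i * Dxi i F.
    rewrite mulr_suml mulr_sumr -sumrB; apply: eq_bigr => i _.
    rewrite mulr_sumr -(sum_delta i (fun j => xi i * Dxi j F)).
    rewrite mulr_sumr -sumrB; apply: eq_bigr => j _.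
    by rewrite DM D_field; ring.
  have -> : \sum_i D i (hom_z a' * hom_field b' i)
      = (\sum_i D i (hom_z a') * hom_field b' i)
        - #|N|%:R * (s b' * ((dual b' == None)%:R * hom_z a')).
    rewrite -[X in _ - X](sum_cst N) -sumrB; apply: eq_bigr => i _.
    by rewrite DM D_field eqxx /=; ring.
  rewrite sum_field_d sum_field_xi sum_hom_z_Dxi sum_hom_z_field eF /gl_op.
  by case: (dual b' == None) => /=; ring: cE.
rewrite /sp_op.
have cancel : s a * (dual a == b)%:R = - (s b * (dual b == a)%:R).
  have [->|ba] := eqVneq b (dual a).
    by rewrite dualK !eqxx sg_dual signrN /=; ring.
  by rewrite -[dual b == a](inj_eq (inv_inj dualK)) dualK (negPf ba) /=; ring.
have -> : hom_lie w (quadratic_field a b) F =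
    \sum_i hom_z a * hom_field b i * D i F
    - \sum_i \sum_j D j (hom_z a * hom_field b i) * (xi i * Dxi j F)
    + w * (\sum_i D i (hom_z a * hom_field b i)) * F
    + (\sum_i hom_z b * hom_field a i * D i F
    - \sum_i \sum_j D j (hom_z b * hom_field a i) * (xi i * Dxi j F)
    + w * (\sum_i D i (hom_z b * hom_field a i)) * F).
  have split2 G H : \sum_i \sum_j D j (G i + H i) * (xi i * Dxi j F)
      = \sum_i \sum_j D j (G i) * (xi i * Dxi j F)
        + \sum_i \sum_j D j (H i) * (xi i * Dxi j F).
    rewrite -big_split; apply: eq_bigr => i _; rewrite -big_split.
    by apply: eq_bigr => j _; rewrite raddfD mulrDl.
  have split1 G H : \sum_i D i (G i + H i)
      = \sum_i D i (G i) + \sum_i D i (H i).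
    by rewrite -big_split; apply: eq_bigr => i _; rewrite raddfD.
  have split0 G H : \sum_i (G i + H i) * D i F
      = \sum_i G i * D i F + \sum_i H i * D i F.
    by rewrite -big_split; apply: eq_bigr => i _; rewrite mulrDl.
  by rewrite /hom_lie /quadratic_field split0 split1 split2; ring.
by rewrite !half; ring: cancel.
Qed.

Lemma hom_lie_linear w Z Z' F :
  hom_lie w (fun i => c * Z i + Z' i) F = c * hom_lie w Z F + hom_lie w Z' F.
Proof.
rewrite /hom_lie.
have -> : \sum_i (c * Z i + Z' i) * D i F
    = c * (\sum_i Z i * D i F) + \sum_i Z' i * D i F.
  by rewrite mulr_sumr -big_split; apply: eq_bigr => i _ /=; ring.
have -> : \sum_i \sum_j D j (c * Z i + Z' i) * (xi i * Dxi j F)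
    = c * (\sum_i \sum_j D j (Z i) * (xi i * Dxi j F))
      + \sum_i \sum_j D j (Z' i) * (xi i * Dxi j F).
  rewrite mulr_sumr -big_split; apply: eq_bigr => i _ /=.
  rewrite mulr_sumr -big_split; apply: eq_bigr => j _ /=.
  by rewrite raddfD Dc /=; ring.
have -> : \sum_i D i (c * Z i + Z' i)
    = c * (\sum_i D i (Z i)) + \sum_i D i (Z' i).
  rewrite mulr_sumr -big_split; apply: eq_bigr => i _ /=.
  by rewrite raddfD Dc.
ring.
Qed.

Lemma hom_d_linear c' a F G :
  hom_d c' a (c * F + G) = c * hom_d c' a F + hom_d c' a G.
Proof.
rewrite raddfD; congr (_ + _); case: a => [i|]; first exact: Dc.
rewrite /hom_d mulrBr mulrN mulr_sumr mulrCA; congr (- _ - _).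
by apply: eq_bigr => i _; rewrite Dc mulrCA.
Qed.

Lemma hom_V_linear a F G :
  hom_V a (c * F + G) = c * hom_V a F + hom_V a G.
Proof.
rewrite raddfD; congr (_ + _); case: a => [i|]; first exact: Dxic.
by rewrite /= mulr0.
Qed.

Lemma contact_op_linear c' F G :
  contact_op dual sg hom_zeta (hom_d c') (c * F + G)
  = c * contact_op dual sg hom_zeta (hom_d c') F
    + contact_op dual sg hom_zeta (hom_d c') G.
Proof.
rewrite /contact_op mulr_sumr -big_split; apply: eq_bigr => a _.
by rewrite /= hom_d_linear; ring.
Qed.

Lemma sp_op_linear c' a b F G :
  sp_op dual sg hom_z hom_zeta (hom_d c') hom_V a b (c * F + G)
  = c * sp_op dual sg hom_z hom_zeta (hom_d c') hom_V a b F
    + sp_op dual sg hom_z hom_zeta (hom_d c') hom_V a b G.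
Proof.
by rewrite /sp_op /gl_op /= !hom_d_linear !hom_V_linear; ring.
Qed.

Lemma contact_contr_linear F G :
  contact_contr dual sg hom_z hom_V (c * F + G)
  = c * contact_contr dual sg hom_z hom_V F
    + contact_contr dual sg hom_z hom_V G.
Proof.
rewrite /contact_contr mulr_sumr -big_split; apply: eq_bigr => a _.
by rewrite /= hom_V_linear; ring.
Qed.

Local Notation L c := (sp_op dual sg hom_z hom_zeta (hom_d c) hom_V).
Local Notation Y c := (contact_op dual sg hom_zeta (hom_d c)).

Lemma hom_dS a F : hom_d (c + 1) a F = hom_d c a F - (a == None)%:R * F.
Proof. by case: a => [i|] /=; ring. Qed.

Lemma sp_opS a b F : L (c + 1) a b F
  = L c a b F - sp_shift None dual sg hom_z a b * F.
Proof. by rewrite /sp_op /gl_op /= !hom_dS /sp_shift; ring. Qed.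

Lemma contact_opS F :
  Y (c + 1) F = Y c F + frame_w0 None dual sg hom_zeta * F.
Proof.
have -> : Y (c + 1) F = Y c F
    - \sum_a (a == dual None)%:R * (s a * (hom_zeta a * F)).
  rewrite /contact_op -sumrB; apply: eq_bigr => a _.
  rewrite /= hom_dS -[dual a == None](inj_eq (inv_inj dualK)) dualK; ring.
by rewrite sum_delta /frame_w0 sg_dual signrN; ring.
Qed.

End CoordinateFrame.

(** * Intertwining relations between the degrees c and c + 1 *)

Section Intertwiners.
Local Open Scope ring_scope.
Variables (K : comNzRingType) (N : finType) (x xi : N -> K).
Variables D Dxi : N -> {additive K -> K}.
Local Notation I := (option N).
Variables (dual : I -> I) (sg : I -> bool) (c : K).
Hypothesis dualK : involutive dual.
Hypothesis sg_dual : forall a, sg (dual a) = ~~ sg a.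
Hypothesis phase : phase_coordinates x xi D Dxi.
Hypothesis Dc : forall i F, D i (c * F) = c * D i F.
Hypothesis Dxic : forall i F, Dxi i (c * F) = c * Dxi i F.

Local Notation z := (hom_z x).
Local Notation zeta := (hom_zeta x xi).
Local Notation d c := (hom_d x D c).
Local Notation V := (hom_V Dxi).
Local Notation L c := (sp_op dual sg z zeta (d c) V).
Local Notation Y c := (contact_op dual sg zeta (d c)).
Local Notation J := (contact_contr dual sg z V).
Local Notation e := (fiber_euler zeta V).

Let frame := hom_frame dualK sg_dual phase Dc Dxic.

Let frameS : homogeneous_frame None dual sg z zeta (c + 1) (d (c + 1)) V.
Proof.
apply: hom_frame => // i F; rewrite mulrDl mul1r raddfD /= ?Dc ?Dxic; ring.
Qed.

Lemma contact_contr_sp_op a b F : J (L (c + 1) a b F) = L c a b (J F).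
Proof. by rewrite (contact_contr_sp frameS) sp_opS; ring. Qed.

Lemma contact_op_sp_op a b F : Y c (L c a b F) = L (c + 1) a b (Y c F).
Proof. by rewrite (contact_op_sp frame) sp_opS. Qed.

Lemma contact_contr_contact_op F :
  J (Y (c + 1) F) = Y c (J F) + e F + (c + 1) * F.
Proof.
by rewrite (contact_contr_op frameS) contact_opS //; ring.
Qed.

Lemma casimir_contact_op F k : e F = k%:R * F ->
  casimir_op dual sg z zeta (d (c + 1)) V F
  = - (2%:R * ((c + 1) * (c + 1 - #|{: I}|%:R)
        + k%:R * (k%:R - 2%:R + #|{: I}|%:R)) * F)
    + 4%:R * Y c (J F).
Proof.
move=> eF; rewrite (casimir_opE frameS eF) contact_opS //; ring.
Qed.

End Intertwiners.

(** Carries the field from coefficient functions to polynomials constant in the momenta, the ring in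
    which [hom_lieE] is applied. *)
Lemma rmorph_quadratic_field (K K' : comNzRingType) (N : finType)
    (h : {rmorphism K -> K'}) (x : N -> K) dual sg (a b : option N) (i : N) :
  (h (quadratic_field x dual sg a b i)
   = quadratic_field (fun i => h (x i)) dual sg a b i)%R.
Proof.
have hz a' : h (hom_z x a') = hom_z (fun i => h (x i)) a'.
  by case: a' => [j|] //=; exact: rmorph1.
have hf b' : h (hom_field x dual sg b' i)
    = hom_field (fun i => h (x i)) dual sg b' i.
  by rewrite /hom_field rmorphM rmorph_sign rmorphB rmorphM !rmorph_nat.
by rewrite /quadratic_field rmorphD 2!rmorphM !hz !hf.
Qed.

(** * Symmetry of second derivatives *)

Section MixedPartials.
Local Open Scope classical_set_scope.
Local Open Scope ring_scope.
Context {R : realType} {m : nat}.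
Implicit Types (f : 'rV[R]_m -> R) (u v x y : 'rV[R]_m).

Lemma is_derive_line f y u s : derivable f (y + s *: u) u ->
  is_derive s 1 (fun s => f (y + s *: u)) ('D_u f (y + s *: u)).
Proof.
move=> df.
have E : (fun h : R =>
    h^-1 *: (f (y + (h *: (1 : R) + s) *: u) - f (y + s *: u)))
  = (fun h => h^-1 *: (f (h *: u + (y + s *: u)) - f (y + s *: u))).
  apply/funext => h; congr (_ *: (f _ - _)).
  by rewrite -[_ *: 1]/(h * 1) mulr1 scalerDl addrCA.
split; first by rewrite /derivable E.
by rewrite /derive E.
Qed.

(** The mean value theorem twice: along u for the increment [phi] in direction v, then along v for
    the derivative ['D_u f]. *)
Lemma second_difference f x u v (h : R) : 0 < h ->
  (forall y, derivable f y u) -> (forall y, derivable ('D_u f) y v) ->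
  exists s t, [/\ 0 < s < h, 0 < t < h &
    f (x + h *: u + h *: v) - f (x + h *: u) - (f (x + h *: v) - f x)
    = 'D_v ('D_u f) (x + s *: u + t *: v) * h * h].
Proof.
move=> h0 du dvu.
pose phi s := f (x + h *: v + s *: u) - f (x + s *: u).
have dphi (s : R) : is_derive s (1 : R) phi
    ('D_u f (x + h *: v + s *: u) - 'D_u f (x + s *: u)).
  by apply: is_deriveB; exact: is_derive_line.
have [|s /[!in_itv]/= s0h] := MVT h0 (fun s _ => dphi s).
  by apply: derivable_within_continuous => s _; have [] := dphi s.
have [|t /[!in_itv]/= t0h] := MVT h0
    (fun t _ => is_derive_line (dvu (x + s *: u + t *: v))).
  apply: derivable_within_continuous => t _.
  by have [] := is_derive_line (dvu (x + s *: u + t *: v)).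
rewrite /phi !scale0r !addr0 !subr0 => Et Es; exists s, t; split=> //.
rewrite -Et [in RHS]addrAC -Es [x + h *: u + _]addrAC; lra.
Qed.

Lemma dist_near_eq (a a' b b' e : R) : a' = b' ->
  `|a - a'| < e / 2 -> `|b - b'| < e / 2 -> `|a - b| <= e.
Proof.
move=> -> aa' bb'; rewrite [e]splitr ltW //.
by apply: le_lt_trans (ler_distD b' _ _) _; rewrite ltrD // distrC.
Qed.

(** The second difference is symmetric in u and v, so for each small h the two mixed derivatives
    share a value at points of the parallelogram of side h; continuity at x concludes. *)
Lemma mixed_partials f u v x :
  (forall y, derivable f y u) -> (forall y, derivable f y v) ->
  (forall y, derivable ('D_u f) y v) -> (forall y, derivable ('D_v f) y u) ->
  {for x, continuous ('D_v ('D_u f))} -> {for x, continuous ('D_u ('D_v f))} ->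
  'D_v ('D_u f) x = 'D_u ('D_v f) x.
Proof.
move=> du dv dvu duv cvu cuv; apply/eqP; rewrite -subr_eq0 -normr_eq0.
apply/eqP/le_anti; rewrite normr_ge0 andbT; apply/ler_addgt0Pr => e e0.
rewrite add0r.
have e20 : 0 < e / 2 by rewrite divr_gt0.
have box (g : 'rV[R]_m -> R) : {for x, continuous g} -> exists2 d : R, 0 < d &
    forall s t, 0 < s < d -> 0 < t < d ->
    `|g x - g (x + s *: u + t *: v)| < e / 2.
  move=> /cvgrPdist_lt /(_ _ e20) /nbhs_normP [r /= r0 rP].
  (* With s and t below this bound, [s *: u + t *: v] has norm less than r; the summand 1 keeps the
     denominator positive. *)
  exists (r / (`|u| + `|v| + 1)) => [|s t /andP[s0 sd] /andP[t0 td]].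
    by rewrite divr_gt0 // ltr_wpDl ?addr_ge0 ?normr_ge0.
  apply: rP => /=; rewrite -addrA opprD addrA subrr sub0r normrN.
  apply: le_lt_trans (ler_normD _ _) _.
  rewrite !normrZ !gtr0_norm //.
  have w0 : 0 < `|u| + `|v| + 1 by rewrite ltr_wpDl ?addr_ge0 ?normr_ge0.
  have -> : r = r / (`|u| + `|v| + 1) * (`|u| + `|v| + 1).
    by rewrite divfK ?gt_eqF.
  rewrite [ltRHS]mulrDr mulr1 ltr_pwDr ?divr_gt0 //.
  by rewrite mulrDr lerD // ler_wpM2r ?normr_ge0 // ltW.
have [d1 d10 H1] := box _ cvu; have [d2 d20 H2] := box _ cuv.
have [h h0 [hd1 hd2]] : exists2 h, 0 < h & h < d1 /\ h < d2.
  have d12 : 0 < Num.min d1 d2 by rewrite lt_min d10.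
  have : Num.min d1 d2 <= d1 by rewrite ge_min lexx.
  have : Num.min d1 d2 <= d2 by rewrite ge_min lexx orbT.
  by exists (Num.min d1 d2 / 2); lra.
have [s [t [/andP[s0 sh] /andP[t0 th] E1]]] := second_difference x h0 du dvu.
have [t' [s' [/andP[t'0 t'h] /andP[s'0 s'h] E2]]] :=
  second_difference x h0 dv duv.
have /eqP E3 : 'D_v ('D_u f) (x + s *: u + t *: v)
    == 'D_u ('D_v f) (x + s' *: u + t' *: v).
  rewrite [x + s' *: u + _]addrAC; move: E1 E2; rewrite [x + h *: v + _]addrAC.
  set a := 'D_v _ _; set b := 'D_u _ _.
  move: a b (f _) (f _) (f _) (f _) => a b f1 f2 f3 f4 E1 E2.
  have hh : h * h != 0 by rewrite mulf_neq0 ?gt_eqF.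
  by apply/eqP/(mulIf hh); rewrite !mulrA -E1 -E2; lra.
have H1' := H1 s t; have H2' := H2 s' t'.
apply: dist_near_eq E3 (H1' _ _) (H2' _ _); apply/andP; split=> //.
- exact: lt_trans hd1.
- exact: lt_trans hd1.
- exact: lt_trans hd2.
- exact: lt_trans hd2.
Qed.

End MixedPartials.

(** * Partial derivatives as commuting derivations of the smooth functions *)

Section SmoothDerivations.
Local Open Scope ring_scope.
Context {R : realType} {m : nat}.
Local Notation A := (smooth_fun R m).
Implicit Types (f g : A) (i j : 'I_m).

Lemma smooth_eq f g : (forall x, f x = g x) -> f = g.
Proof. by move=> fg; apply/val_inj/funext. Qed.

Lemma smooth_derivable i f x : derivable f x (unit_vec i).
Proof.
by case: f => f Pf; have /asboolP/(_ 1%N) [_ /(_ i) []] := Pf.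
Qed.

Lemma smooth_continuous f : continuous f.
Proof. by case: f => f Pf; have /asboolP/(_ 0%N) [] := Pf. Qed.

Lemma partialC i j f : partial i (partial j f) = partial j (partial i f).
Proof.
apply: smooth_eq => x; apply: mixed_partials.
- exact: smooth_derivable.
- exact: smooth_derivable.
- exact: (@smooth_derivable i (partial j f)).
- exact: (@smooth_derivable j (partial i f)).
- exact: (@smooth_continuous (partial i (partial j f))).
- exact: (@smooth_continuous (partial j (partial i f))).
Qed.

Lemma partial_linear i (c : R) f g :
  partial i (c *: f + g) = c *: partial i f + partial i g.
Proof.
apply: smooth_eq => x; rewrite /= deriveD ?deriveZ //.
- exact: smooth_derivable.
- exact/derivableZ/smooth_derivable.
- exact: smooth_derivable.
Qed.

Lemma partial_is_zmod_morphism i : zmod_morphism (partial i : A -> A).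
Proof.
move=> f g; rewrite -[- g]scaleN1r addrC partial_linear scaleN1r.
exact: addrC.
Qed.

HB.instance Definition _ i :=
  GRing.isZmodMorphism.Build A A (partial i) (partial_is_zmod_morphism i).

Lemma partialZ i (c : R) f : partial i (c *: f) = c *: partial i f.
Proof. by rewrite -[c *: f]addr0 partial_linear raddf0 addr0. Qed.

Lemma partialM i f g : partial i (f * g) = f * partial i g + partial i f * g.
Proof.
apply: smooth_eq => x; rewrite /= deriveM; [|exact: smooth_derivable..].
by rewrite [X in _ + X]mulrC.
Qed.

Lemma partial1 i : partial i (1 : A) = 0.
Proof. by apply: smooth_eq => x; exact: derive_cst. Qed.

Lemma partial_coord i j : partial i (Defs.coord j : A) = (i == j)%:R.
Proof.
apply: smooth_eq => x; have [_ /= ->] := is_derive_coord j x (unit_vec i).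
rewrite mxE eqxx eq_sym /=.
by case: (i == j).
Qed.

End SmoothDerivations.

(** * Polynomials over smooth functions *)

Section SmoothPolynomials.
Local Open Scope ring_scope.
Context {R : realType} {m : nat}.
Local Notation A := (smooth_fun R m).
Local Notation tens := (mpoly m A).
Local Notation xi i := (mpolyX A (mnm1 i) : tens).
Local Notation dxi i := (@mderiv m A i).
Local Notation dx i := (@map_mpoly m A A (partial i)).
Implicit Types (P Q : tens) (f g : A) (i j : 'I_m).

Lemma map_mpoly_ZX (h : {additive A -> A}) f (u : multinom m) :
  map_mpoly h (f *: mpolyX A u : tens) = h f *: mpolyX A u.
Proof.
apply/mpolyP => v; rewrite mcoeff_map_mpoly !mcoeffZ !mcoeffX.
by case: (_ == _); rewrite ?mulr1 ?mulr0 ?raddf0.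
Qed.

Lemma dxM i P Q : dx i (P * Q) = P * dx i Q + dx i P * Q.
Proof.
elim/mpolyind: P => [|f u P _ _ IH].
  by rewrite !(mul0r, raddf0, addr0).
rewrite mulrDl !raddfD /= IH !mulrDl addrACA; congr (_ + _).
elim/mpolyind: Q {P IH} => [|g v Q _ _ IH].
  by rewrite !(mulr0, raddf0, addr0).
rewrite mulrDr !raddfD /= IH !mulrDr addrACA; congr (_ + _).
rewrite -scalerAl -scalerAr scalerA -mpolyXD !map_mpoly_ZX /= partialM scalerDl.
by rewrite -!scalerAl -!scalerAr !scalerA -!mpolyXD.
Qed.

Lemma dxC i f : dx i (mpolyC m f) = mpolyC m (partial i f).
Proof. exact: map_mpolyC. Qed.

Lemma dx_xi i j : dx i (xi j) = 0.
Proof.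
by rewrite -[mpolyX _ _]scale1r map_mpoly_ZX /= partial1 scale0r.
Qed.

Lemma dxi_xi i j : dxi i (xi j) = (i == j)%:R.
Proof.
rewrite mderivX mnm1E eq_sym; case: eqVneq => [->|_]; last by rewrite scale0r.
rewrite scale1r -(mpolyX0 m A); congr (mpolyX _ _).
by apply/mnmP => k; rewrite mnmBE subnn mnm0E.
Qed.

Lemma mcoeff_dx i P u : mcoeff u (dx i P) = partial i (mcoeff u P).
Proof. exact: mcoeff_map_mpoly. Qed.

Lemma dx_comm i j P : dx i (dx j P) = dx j (dx i P).
Proof.
have E i' j' u :
    mcoeff u (dx i' (dx j' P)) = partial i' (partial j' (mcoeff u P)).
  by rewrite mcoeff_dx mcoeff_dx.
apply/mpolyP => u.
exact: etrans (E i j u) (etrans (partialC _ _ _) (esym (E j i u))).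
Qed.

Lemma dx_dxi i j P : dx i (dxi j P) = dxi j (dx i P).
Proof.
apply/mpolyP => u; apply: etrans (mcoeff_dx _ _ _) _.
apply: etrans (congr1 (partial i) (mcoeff_mderiv _ _ _)) _.
rewrite (raddfMn (partial i)); apply: esym.
apply: etrans (mcoeff_mderiv _ _ _) _.
by congr (_ *+ _); exact: mcoeff_dx.
Qed.

Lemma dx_homog k i P : P \is ishomog1 k mdeg -> dx i P \is ishomog1 k mdeg.
Proof.
move=> hP; apply/dhomogP => u; rewrite mcoeff_msupp mcoeff_dx => nz.
apply/eqP; apply: contraNT nz => /(dhomog_nemf_coeff hP) ->.
by rewrite raddf0.
Qed.

Lemma dxi_homog k i P : P \is ishomog1 k mdeg -> dxi i P \is ishomog1 k.-1 mdeg.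
Proof.
move=> hP; apply/dhomogP => v; rewrite mcoeff_msupp mcoeff_mderiv => nz.
apply/eqP; apply: contraNT nz => nz.
rewrite (dhomog_nemf_coeff hP) ?mul0rn //.
by apply: contra nz => /eqP <-; rewrite [X in _ == X.-1]mdegD mdeg1 addn1.
Qed.

Lemma xi_homog i : xi i \is ishomog1 1 mdeg.
Proof.
by rewrite dhomogX; apply/eqP; exact: mdeg1.
Qed.

Lemma dxi_homog0 i P : P \is ishomog1 0 mdeg -> dxi i P = 0.
Proof.
move=> hP; apply/mpolyP => v; rewrite mcoeff_mderiv mcoeff0.
by rewrite (dhomog_nemf_coeff hP) ?mul0rn // [X in X == _]mdegD mdeg1 addn1.
Qed.

Lemma xi_dxi_homog k i j P :
  P \is ishomog1 k mdeg -> xi i * dxi j P \is ishomog1 k mdeg.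
Proof.
(* In degree 0 the truncated predecessor breaks the degree count, but the fibre derivative is zero
   there. *)
case: k => [|k] hP; first by rewrite (dxi_homog0 _ hP) mulr0 rpred0.
by apply: (@dhomogM _ _ _ 1%N) (xi_homog i) (dxi_homog j hP).
Qed.

Lemma euler_homog k P : P \is ishomog1 k mdeg ->
  \sum_i xi i * dxi i P = k%:R * P.
Proof.
move=> /dhomogP hP; rewrite [P]mpolyE.
under eq_bigr do rewrite raddf_sum mulr_sumr.
rewrite exchange_big mulr_sumr !big_seq; apply: eq_bigr => u uP /=.
under eq_bigr => i _.
  rewrite mderivZ mderivX -scalerAr -scalerAr -mpolyXD.
  (* Lowering the exponent and raising it again restores [u] unless [u i = 0], where the subtraction
     is truncated but the coefficient vanishes. *)
  rewrite (_ : (u i)%:R *: _ = (u i)%:R *: mpolyX A u); last first.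
    have [->|u0] := eqVneq (u i) 0%N; first by rewrite !scale0r.
    congr (_ *: mpolyX _ _); rewrite addmC submK //; apply/mnm_lepP => j.
    by rewrite mnm1E; case: eqVneq => // <-; rewrite lt0n.
  over.
rewrite -scaler_sumr -scaler_suml -natr_sum -mdegE (hP _ uP) mulr_natl.
by rewrite scaler_nat scalerMnr.
Qed.

End SmoothPolynomials.

(** * The contact frame *)

Section ContactFrame.
Local Open Scope ring_scope.
Context {R : realType} {n : nat}.
Local Notation m := (cdim n).
Local Notation A := (smooth_fun R m).
Local Notation tens := (mpoly m A).
Local Notation xi i := (mpolyX A (mnm1 i) : tens).
Local Notation dxi i := (@mderiv m A i).
Local Notation dx i := (@map_mpoly m A A (partial i)).
Local Notation I := (option 'I_m).
Local Notation x i := (mpolyC m (Defs.coord i : A)).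
Implicit Types (P Q : tens) (f g : A) (i j : 'I_m) (a b : I) (c : R).

Lemma cst_fun_is_zmod_morphism : zmod_morphism (cst_fun : R -> A).
Proof. by move=> c c'; rewrite /cst_fun scalerBl. Qed.

Lemma cst_funZ c f : cst_fun c * f = c *: f.
Proof. by apply: smooth_eq => y; rewrite -[LHS]/(c * 1 * f y) mulr1. Qed.

Lemma cst_fun_is_monoid_morphism : monoid_morphism (cst_fun : R -> A).
Proof.
split=> [|c c']; first by rewrite /cst_fun scale1r.
by rewrite cst_funZ /cst_fun scalerA.
Qed.

HB.instance Definition _ :=
  GRing.isZmodMorphism.Build R A cst_fun cst_fun_is_zmod_morphism.
HB.instance Definition _ :=
  GRing.isMonoidMorphism.Build R A cst_fun cst_fun_is_monoid_morphism.

Definition constT c : tens := mpolyC m (cst_fun c).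
HB.instance Definition _ :=
  GRing.RMorphism.copy constT (@mpolyC m A \o cst_fun).

Lemma constTE c P : constT c * P = cst_fun c *: P.
Proof. exact: mul_mpolyC. Qed.

Lemma dx_cst i c P : dx i (constT c * P) = constT c * dx i P.
Proof.
by rewrite dxM dxC /cst_fun partialZ partial1 scaler0 raddf0 mul0r addr0.
Qed.

Lemma dxi_cst i c P : dxi i (constT c * P) = constT c * dxi i P.
Proof. exact: mderiv_mulC. Qed.

(* The index None stands for the extra homogeneous coordinate and is dual to
   that of t. *)
Definition frame_dual a : I :=
  if a isn't Some i then Some idx_t else
  if fintype.split i is inl j then
    match fintype.split j with
    | inl k => Some (idx_q k)
    | inr k => Some (idx_p k)
    end
  else None.
(** These signs make (p_j, q^j) and (t, z_o) Darboux pairs, matching the signs of the contact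
    form. *)
Definition frame_sg a : bool :=
  if a isn't Some i then true else
  if fintype.split i is inl j then ~~ is_inl (fintype.split j) else false.

Lemma split_lshift p q (j : 'I_p) : fintype.split (lshift q j) = inl j.
Proof. exact: (unsplitK (inl j)). Qed.

Lemma split_rshift p q (j : 'I_q) : fintype.split (rshift p j) = inr j.
Proof. exact: (unsplitK (inr j)). Qed.

Definition split_shift := (split_lshift, split_rshift).

Lemma frame_dual_p (j : 'I_n) : frame_dual (Some (idx_p j)) = Some (idx_q j).
Proof. by rewrite /frame_dual /idx_p !split_shift. Qed.

Lemma frame_dual_q (j : 'I_n) : frame_dual (Some (idx_q j)) = Some (idx_p j).
Proof. by rewrite /frame_dual /idx_q !split_shift. Qed.

Lemma frame_dual_t : frame_dual (Some idx_t) = None.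
Proof. by rewrite /frame_dual /idx_t !split_shift. Qed.

Lemma frame_sg_p (j : 'I_n) : frame_sg (Some (idx_p j)) = false.
Proof. by rewrite /frame_sg /idx_p !split_shift. Qed.

Lemma frame_sg_q (j : 'I_n) : frame_sg (Some (idx_q j)) = true.
Proof. by rewrite /frame_sg /idx_q !split_shift. Qed.

Lemma frame_sg_t : frame_sg (Some idx_t) = false.
Proof. by rewrite /frame_sg /idx_t !split_shift. Qed.

Definition frame_dualE := (frame_dual_p, frame_dual_q, frame_dual_t).
Definition frame_sgE := (frame_sg_p, frame_sg_q, frame_sg_t).

Variant cdim_spec : 'I_m -> Type :=
  | CdimP (j : 'I_n) : cdim_spec (idx_p j)
  | CdimQ (j : 'I_n) : cdim_spec (idx_q j)
  | CdimT : cdim_spec idx_t.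

Lemma cdimP i : cdim_spec i.
Proof.
rewrite -(splitK i); case: (fintype.split i) => [k|k] /=; last first.
  by rewrite (ord1 k); exact: CdimT.
rewrite -(splitK k); case: (fintype.split k) => j /=; first exact: CdimP.
exact: CdimQ.
Qed.

Lemma sum_cdim (V : nmodType) (F : 'I_m -> V) :
  \sum_i F i = \sum_(j < n) (F (idx_p j) + F (idx_q j)) + F idx_t.
Proof.
rewrite big_split_ord big_ord1 /=; congr (_ + _).
by rewrite big_split_ord /= -big_split.
Qed.

Lemma card_frame : #|{: I}| = (2 * n.+1)%N.
Proof. by rewrite card_option card_ord /cdim; lia. Qed.

Lemma frame_dualK : involutive frame_dual.
Proof.
case=> [i|]; last by rewrite frame_dual_t.
by case: (cdimP i) => [j|j|]; rewrite !frame_dualE.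
Qed.

Lemma frame_sg_dual a : frame_sg (frame_dual a) = ~~ frame_sg a.
Proof.
case: a => [i|]; last by rewrite frame_sg_t.
by case: (cdimP i) => [j|j|]; rewrite frame_dualE !frame_sgE.
Qed.

Definition phase_x i : tens := x i.
Definition phase_xi i : tens := xi i.
Definition phase_D i : {additive tens -> tens} := dx i.
Definition phase_Dxi i : {additive tens -> tens} := dxi i.

Lemma tensor_phase : phase_coordinates phase_x phase_xi phase_D phase_Dxi.
Proof.
split=> [i F G|i F G|i j|i j|i j|i j|i j F|i j F|i j F].
- exact: dxM.
- exact: mderivM.
- apply: etrans (dxC i _) _; rewrite partial_coord.
  by case: (i == j); [exact: mpolyC1 | exact: mpolyC0].
- exact: dx_xi.
- exact: mderivC.
- exact: dxi_xi.
- exact: dx_comm.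
- exact: mderiv_comm.
- exact: dx_dxi.
Qed.

Local Notation z := (hom_z phase_x).
Local Notation zeta := (hom_zeta phase_x phase_xi).
Local Notation d c := (hom_d phase_x phase_D (constT c)).
Local Notation V := (hom_V phase_Dxi).

Lemma constTS c : constT (c + 1) = constT c + 1.
Proof. by rewrite rmorphD rmorph1. Qed.

Definition spL c a b : tens -> tens :=
  sp_op frame_dual frame_sg z zeta (d c) V a b.
Definition opY c : tens -> tens :=
  contact_op frame_dual frame_sg zeta (d c).
Definition opJ : tens -> tens := contact_contr frame_dual frame_sg z V.

Lemma opJ_spL c a b P : opJ (spL (c + 1) a b P) = spL c a b (opJ P).
Proof.
rewrite /spL constTS.
exact: (contact_contr_sp_op frame_dualK frame_sg_dual tensor_phase
          (fun i => @dx_cst i c) (fun i => @dxi_cst i c)).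
Qed.

Lemma opY_spL c a b P : opY c (spL c a b P) = spL (c + 1) a b (opY c P).
Proof.
rewrite /spL constTS.
exact: (contact_op_sp_op frame_dualK frame_sg_dual tensor_phase
          (fun i => @dx_cst i c) (fun i => @dxi_cst i c)).
Qed.

Lemma tensor_euler k P : P \is ishomog1 k mdeg ->
  fiber_euler zeta V P = k%:R * P.
Proof. by move=> hP; rewrite hom_euler; exact: euler_homog. Qed.

Lemma opJ_opY c k P : P \is ishomog1 k mdeg ->
  opJ (opY (c + 1) P) = opY c (opJ P) + constT (k%:R + (c + 1)) * P.
Proof.
have -> : constT (k%:R + (c + 1)) = k%:R + (constT c + 1).
  by rewrite rmorphD rmorph_nat /= constTS.
move=> /tensor_euler eP; rewrite mulrDl addrA -eP /opY constTS.
exact: (contact_contr_contact_op frame_dualK frame_sg_dual tensor_phase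
          (fun i => @dx_cst i c) (fun i => @dxi_cst i c)).
Qed.

End ContactFrame.

(** * Contact operators and contact Hamiltonian fields in coordinates *)

Section ContactOperators.
Local Open Scope ring_scope.
Context {R : realType} {n : nat}.
Local Notation m := (cdim n).
Local Notation A := (smooth_fun R m).
Local Notation tens := (mpoly m A).
Local Notation xi i := (mpolyX A (mnm1 i) : tens).
Local Notation dxi i := (@mderiv m A i).
Local Notation dx i := (@map_mpoly m A A (partial i)).
Local Notation I := (option 'I_m).
Local Notation x i := (mpolyC m (Defs.coord i : A)).
Implicit Types (P Q S : tens) (f g h : A) (i j : 'I_m) (a b : I) (c : R).
Local Notation s a := ((-1) ^+ @frame_sg n a : tens).

Local Notation cstT := (@constT R n).
Local Notation vfield := 'rV[A]_m.

Lemma sum_frame (U : nmodType) (G : I -> U) :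
  \sum_a G a = G None + (\sum_(j < n) (G (Some (idx_p j)) + G (Some (idx_q j)))
                         + G (Some idx_t)).
Proof. by rewrite sum_option sum_cdim. Qed.

Lemma opJE S : opJ S =
  \sum_(j < n) (x (idx_p j) * dxi (idx_q j) S - x (idx_q j) * dxi (idx_p j) S)
  - dxi idx_t S.
Proof.
have sgN : s None = - 1 by [].
have sgT : s (Some idx_t) = 1 by rewrite frame_sg_t.
rewrite /opJ /contact_contr sum_frame sgN sgT frame_dual_t !mul1r mulN1r.
rewrite mulr0 addr0 addrC; congr (_ - _); apply: eq_bigr => j _.
by rewrite !frame_dualE frame_sg_p frame_sg_q mul1r mulN1r.
Qed.

Lemma i_alphaE S : i_alpha S = cstT 2%:R^-1 * opJ S.
Proof.
rewrite opJE constTE /i_alpha; congr (_ *: (_ - _)).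
by apply: eq_bigr => j _; rewrite -!mul_mpolyC.
Qed.

Lemma idx_pE (j k : 'I_n) : (idx_p j == idx_p k) = (j == k).
Proof. by rewrite !eq_lshift. Qed.
Lemma idx_qE (j k : 'I_n) : (idx_q j == idx_q k) = (j == k).
Proof. by rewrite eq_lshift eq_rshift. Qed.
Lemma idx_pq (j k : 'I_n) : (idx_p j == idx_q k) = false.
Proof. by rewrite eq_lshift eq_lrshift. Qed.
Lemma idx_qp (j k : 'I_n) : (idx_q j == idx_p k) = false.
Proof. by rewrite eq_lshift eq_rlshift. Qed.
Lemma idx_pt (j : 'I_n) : (idx_p j == idx_t) = false.
Proof. by rewrite eq_lrshift. Qed.
Lemma idx_qt (j : 'I_n) : (idx_q j == idx_t) = false.
Proof. by rewrite eq_lrshift. Qed.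
Lemma idx_tp (j : 'I_n) : (idx_t == idx_p j) = false.
Proof. by rewrite eq_rlshift. Qed.
Lemma idx_tq (j : 'I_n) : (idx_t == idx_q j) = false.
Proof. by rewrite eq_rlshift. Qed.

Definition idxE :=
  (idx_pE, idx_qE, idx_pq, idx_qp, idx_pt, idx_qt, idx_tp, idx_tq).

Lemma sum_dvec (F : 'I_m -> A) i : (\sum_i F i *: dvec i : vfield) 0 i = F i.
Proof.
rewrite summxE (bigD1 i) //= big1 => [|j /negPf ji].
  by rewrite !mxE !eqxx mulr1 addr0.
by rewrite !mxE eqxx eq_sym ji mulr0.
Qed.

Lemma euler_sE :
  (euler_s : vfield)
  = \sum_i (if i == idx_t then 0 else Defs.coord i) *: dvec i.
Proof.
rewrite sum_cdim eqxx scale0r addr0; apply: eq_bigr => j _.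
by rewrite idx_pt idx_qt.
Qed.

Lemma vderive_euler h : vderive (euler_s : vfield) h
  = \sum_i (if i == idx_t then 0 else Defs.coord i) * partial i h.
Proof.
by rewrite euler_sE /vderive; apply: eq_bigr => i _; rewrite sum_dvec.
Qed.

Definition ham_field (h : A) i : A :=
  if fintype.split i is inl k then
    match fintype.split k with
    | inl j => - partial (idx_q j) h - partial idx_t h * Defs.coord (idx_p j)
    | inr j => partial (idx_p j) h - partial idx_t h * Defs.coord (idx_q j)
    end
  else vderive euler_s h - 2%:R * h.

Lemma ham_field_p h (j : 'I_n) : ham_field h (idx_p j)
  = - partial (idx_q j) h - partial idx_t h * Defs.coord (idx_p j).
Proof. by rewrite /ham_field /idx_p !split_shift. Qed.

Lemma ham_field_q h (j : 'I_n) : ham_field h (idx_q j)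
  = partial (idx_p j) h - partial idx_t h * Defs.coord (idx_q j).
Proof. by rewrite /ham_field /idx_q !split_shift. Qed.

Lemma ham_field_t h : ham_field h idx_t = vderive euler_s h - 2%:R * h.
Proof. by rewrite /ham_field /idx_t !split_shift. Qed.

Lemma scale_combine (K : nzRingType) (U : lmodType K) (k1 k2 k3 k4 k5 : K)
    (u v : U) :
  k1 *: v - k2 *: u - k3 *: (k4 *: u + k5 *: v)
  = (- k2 - k3 * k4) *: u + (k1 - k3 * k5) *: v.
Proof.
rewrite scalerDr !scalerA opprD [X in X + _ = _]addrC addrACA.
by rewrite !scalerBl scaleNr.
Qed.

Lemma contact_hamE h i : contact_ham h 0 i = ham_field h i.
Proof.
rewrite -(sum_dvec (ham_field h)); congr (fun_of_matrix _ _ _).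
rewrite sum_cdim ham_field_t scalerBl addrA /contact_ham; congr (_ - _).
rewrite addrAC; congr (_ + _); rewrite /euler_s scaler_sumr -sumrB.
by apply: eq_bigr => j _; rewrite ham_field_p ham_field_q scale_combine.
Qed.

Lemma vderiveM (Z : vfield) f g :
  vderive Z (f * g) = f * vderive Z g + g * vderive Z f.
Proof.
rewrite /vderive !mulr_sumr -big_split; apply: eq_bigr => i _ /=.
rewrite partialM mulrDr mulrCA; congr (_ + _).
by rewrite [_ * g]mulrC mulrCA.
Qed.

(** All terms of X_h are first order in h except - 2h d/dt, which alone violates the Leibniz
    rule. *)
Lemma ham_fieldM f g i : ham_field (f * g) i
  = f * ham_field g i + g * ham_field f i + (i == idx_t)%:R * (2%:R * (f * g)).
Proof.
case: (cdimP i) => [j|j|]; rewrite ?(ham_field_p, ham_field_q, ham_field_t).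
- rewrite !partialM idx_pt.
  move: (partial _ f) (partial _ g) (partial _ f) (partial _ g) (Defs.coord _).
  by move=> a b a' b' e /=; ring.
- rewrite !partialM idx_qt.
  move: (partial _ f) (partial _ g) (partial _ f) (partial _ g) (Defs.coord _).
  by move=> a b a' b' e /=; ring.
- rewrite vderiveM eqxx; move: (vderive _ _) (vderive _ _) => a b /=.
  by ring.
Qed.

Local Notation Az := (@hom_z A 'I_m (fun i => Defs.coord i)).
Local Notation Afield :=
  (@hom_field A 'I_m (fun i => Defs.coord i) frame_dual frame_sg).

Lemma vderive_euler_coord k :
  vderive (euler_s : vfield) (Defs.coord k)
  = if k == idx_t then 0 else Defs.coord k.
Proof.
rewrite vderive_euler (bigD1 k) //= partial_coord eqxx mulr1 big1 ?addr0 //.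
by move=> i /negPf ik; rewrite partial_coord ik mulr0.
Qed.

Lemma vderive1 (Z : vfield) : vderive Z 1 = 0.
Proof. by rewrite /vderive big1 // => i _; rewrite partial1 mulr0. Qed.

(** The correction along t is half of the Leibniz defect, so that the two corrections cancel the
    defect for a product z_a z_b. *)
Lemma ham_field_z b i :
  ham_field (Az b) i = Afield b i - (i == idx_t)%:R * Az b.
Proof.
have eS (k l : 'I_m) : (Some k == Some l) = (k == l) by [].
have eN (k : 'I_m) : (Some k == None) = false by [].
have eN' (k : 'I_m) : (None == Some k) = false by [].
have zS k : Az (Some k) = Defs.coord k by [].
have pc k l : partial k (Defs.coord l : A) = (l == k)%:R.
  by rewrite partial_coord eq_sym.
rewrite /hom_field; case: b => [k|]; last first.
  have -> : @frame_dual n None = Some idx_t by [].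
  have -> : Az None = 1 by [].
  have -> : @frame_sg n None = true by [].
  rewrite eS eN; case: (cdimP i) => [j|j|];
  rewrite ?(ham_field_p, ham_field_q, ham_field_t) ?vderive1 ?partial1 ?idxE.
  - by rewrite /=; ring.
  - by rewrite /=; ring.
  - by rewrite eqxx /=; ring.
rewrite zS; case: (cdimP k) => [l|l|]; case: (cdimP i) => [j|j|];
  rewrite ?(ham_field_p, ham_field_q, ham_field_t) ?vderive_euler_coord ?pc;
  rewrite ?frame_dualE ?frame_sgE ?eS ?eN ?eN' ?idxE ?eqxx /=; ring.
Qed.

Lemma contact_ham_z a b i : contact_ham (Az a * Az b) 0 i
  = quadratic_field (fun i => Defs.coord i) frame_dual frame_sg a b i.
Proof.
rewrite contact_hamE ham_fieldM !ham_field_z /quadratic_field.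
move: (Az a) (Az b) (Afield a i) (Afield b i) => u v u' v'.
by case: (i == idx_t) => /=; ring.
Qed.

Lemma vderive_is_zmod_morphism (Z : vfield) : zmod_morphism (vderive Z).
Proof.
move=> f g; rewrite /vderive -sumrB; apply: eq_bigr => i _.
by rewrite raddfB mulrBr.
Qed.

HB.instance Definition _ (Z : vfield) :=
  GRing.isZmodMorphism.Build A A (vderive Z) (vderive_is_zmod_morphism Z).

Lemma map_vderive (Z : vfield) P :
  map_mpoly (vderive Z) P = \sum_i mpolyC m (Z 0 i) * dx i P.
Proof.
apply/mpolyP => u; rewrite mcoeff_map_mpoly raddf_sum /=.
by apply: eq_bigr => i _; rewrite mcoeffCM mcoeff_dx.
Qed.

Local Notation quad :=
  (quadratic_field (@phase_x R n) frame_dual frame_sg).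

Lemma lieE w (Z : vfield) P : lie w Z P
  = hom_lie (@phase_xi R n) (@phase_D R n) (@phase_Dxi R n) (cstT w)
      (fun i => mpolyC m (Z 0 i)) P.
Proof.
rewrite /lie /hom_lie map_vderive; congr (_ - _ + _).
  apply: eq_bigr => i _; apply: eq_bigr => j _.
  rewrite -mul_mpolyC; congr (_ * _); exact: esym (dxC _ _).
rewrite -mul_mpolyC rmorphM; congr (_ * _ * _).
by rewrite rmorph_sum; apply: eq_bigr => i _; exact: esym (dxC _ _).
Qed.

Lemma cstT_nat k : cstT k%:R = k%:R.
Proof. exact: rmorph_nat. Qed.

Lemma lie_spL delta k a b P : P \is ishomog1 k mdeg ->
  lie (Rk_weight n delta k) (contact_ham (Az a * Az b)) P
  = spL (2%:R * n.+1%:R * delta + k%:R) a b P.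
Proof.
move=> /tensor_euler eP; rewrite lieE.
have -> : (fun i => mpolyC m ((contact_ham (Az a * Az b) : vfield) 0 i))
    = quad a b.
  apply/funext => i; rewrite contact_ham_z.
  exact: (rmorph_quadratic_field (@mpolyC m A)).
(* The degree condition of [hom_lieE]: the dimension plus one is 2(n+1), and multiplying it by delta
   + k/(n+1) gives 2(n+1) delta + 2k. *)
have cE : cstT (2%:R * n.+1%:R * delta + k%:R) + k%:R
    = cstT (Rk_weight n delta k) * (#|'I_m|%:R + 1).
  have -> : #|'I_m|%:R + 1 = cstT (2%:R * n.+1%:R).
    by rewrite -natrM cstT_nat card_ord natr1; congr _%:R; rewrite /cdim; lia.
  rewrite -cstT_nat -(rmorphD cstT) -(rmorphM cstT); congr constT.
  rewrite /Rk_weight.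
  have n1 : n.+1%:R != 0 :> R by rewrite pnatr_eq0.
  by move: (n.+1%:R) n1 => N N0; field.
exact: (hom_lieE (@frame_dualK n) (@frame_sg_dual n) (@tensor_phase R n) a b
  eP cE).
Qed.

Lemma opY_regroup (K : comNzRingType) (k1 k2 k3 k4 : K) :
  - (- k1 * k2) + (k3 + k4) = k3 + k4 + k1 * k2.
Proof. ring. Qed.

Lemma opYE c S : opY c S =
  \sum_(j < n) (xi (idx_p j) * dx (idx_q j) S - xi (idx_q j) * dx (idx_p j) S)
  + xi idx_t * (- (\sum_i x i * dx i S) - cstT c * S)
  + (\sum_i x i * xi i) * dx idx_t S.
Proof.
have sgN : s None = - 1 by [].
have sgT : s (Some idx_t) = 1 by rewrite frame_sg_t.
rewrite /opY /contact_op sum_frame sgN sgT frame_dual_t !mul1r mulN1r.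
apply: etrans (opY_regroup _ _ _ _) _; congr (_ + _ + _); apply: eq_bigr => j _.
by rewrite !frame_dualE frame_sg_p frame_sg_q mul1r mulN1r.
Qed.

(** Here [y1], [y2], [y3] stand for xi_t, t and dS/dt. The homogeneous form has two more terms in t,
    from d_o and zeta_o, which cancel each other. *)
Lemma gen_ham_regroup (K : comNzRingType) (F W W' u u' u0 v v' w y1 y2 y3 : K) :
  W' = - W -> u' = u -> u0 = 0 -> v' = v ->
  W' + y1 * (u' + u0) - v' * y3 + w * (y1 * F)
  = - (W + y1 * (- (u + y2 * y3) - w * F) + (v + y2 * y1) * y3).
Proof. move=> -> -> -> ->; ring. Qed.

Lemma gen_hamE delta k S :
  gen_ham delta k S = - opY (2%:R * n.+1%:R * delta + k%:R) S.
Proof.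
rewrite opYE /gen_ham map_vderive -constTE !sum_cdim.
apply: gen_ham_regroup.
- by rewrite -sumrN; apply: eq_bigr => j _; rewrite opprB.
- by apply: eq_bigr => j _; rewrite !euler_sE !sum_dvec idx_pt idx_qt.
- by rewrite euler_sE sum_dvec eqxx mpolyC0 mul0r.
- by apply: eq_bigr => j _; rewrite -!mul_mpolyC.
Qed.

End ContactOperators.

(** * The action of the contact fields of quadratic Hamiltonians *)

Section SpAction.
Local Open Scope classical_set_scope.
Local Open Scope ring_scope.
Context {R : realType} {n : nat}.
Local Notation m := (cdim n).
Local Notation A := (smooth_fun R m).
Local Notation tens := (mpoly m A).
Local Notation I := (option 'I_m).
Local Notation vfield := 'rV[A]_m.
Local Notation cstT := (@constT R n).
Local Notation Az := (@hom_z A 'I_m (fun i => Defs.coord i)).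
Implicit Types (P Q S : tens) (f g h : A) (i j : 'I_m) (a b : I)
  (c delta w : R).

Lemma constTN1 : cstT (- 1) = - 1.
Proof. exact: rmorphN1. Qed.

Lemma lie_linear w c f g S :
  lie w (contact_ham (c *: f + g)) S
  = cstT c * lie w (contact_ham f) S + lie w (contact_ham g) S.
Proof.
rewrite !lieE; apply: etrans (hom_lie_linear (@phase_xi R n) (@phase_Dxi R n)
  (c := cstT c) (fun i => @dx_cst R n i c) _ _ _ _).
congr (hom_lie _ _ _ _ _ _); apply/funext => i.
rewrite /constT -rmorphM -rmorphD !contact_hamE; congr (mpolyC _ _).
rewrite -cst_funZ.
have pc j : partial j (cst_fun c * f + g)
    = cst_fun c * partial j f + partial j g.
  by rewrite !cst_funZ partial_linear.
have vc : vderive (euler_s : vfield) (cst_fun c * f + g)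
    = cst_fun c * vderive euler_s f + vderive euler_s g.
  rewrite raddfD /= vderiveM; congr (_ + _).
  rewrite /vderive [X in _ + f * X]big1 ?mulr0 ?addr0 // => j _.
  by rewrite /cst_fun partialZ partial1 scaler0 mulr0.
case: (cdimP i) => [j|j|]; rewrite ?(ham_field_p, ham_field_q, ham_field_t).
- rewrite !pc.
  move: (partial _ _) (partial _ _) (partial _ _) (partial _ _) => *; ring.
- rewrite !pc.
  move: (partial _ _) (partial _ _) (partial _ _) (partial _ _) => *; ring.
- rewrite vc; move: (vderive _ _) (vderive _ _) => *; ring.
Qed.

Lemma lie_homog w (Z : vfield) k P :
  sym_tensor n k P -> sym_tensor n k (lie w Z P).
Proof.
rewrite /sym_tensor /= => hP; rewrite /lie map_vderive.
apply: rpredD; [apply: rpredB|].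
- by apply: rpred_sum => i _; rewrite mul_mpolyC; exact/dhomogZ/dx_homog.
- apply: rpred_sum => i _; apply: rpred_sum => j _.
  exact/dhomogZ/xi_dxi_homog.
- exact: dhomogZ.
Qed.

Definition poly_z a : mpoly m R := if a is Some i then mpolyX R (mnm1 i) else 1.

Lemma poly_fun_z a b : poly_fun (poly_z a * poly_z b) = Az a * Az b.
Proof.
have E a' : poly_fun (poly_z a') = Az a'.
  case: a' => [i|]; rewrite /poly_fun /=; first by rewrite mmapX mmap1U.
  exact: rmorph1.
by rewrite /poly_fun rmorphM /= -!E.
Qed.

Lemma sp_alg_z a b : sp_alg (contact_ham (Az a * Az b) : vfield).
Proof.
exists (poly_z a * poly_z b); last by rewrite poly_fun_z.
case: a b => [i|] [j|]; rewrite /= ?mulr1 ?mul1r.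
- by rewrite -mpolyXD mmeasureX -[X in X.+1]/(mdeg _) mdegD !mdeg1.
- by rewrite mmeasureX -[X in X.+1]/(mdeg _) mdeg1.
- by rewrite mmeasureX -[X in X.+1]/(mdeg _) mdeg1.
- by rewrite mmeasure1.
Qed.

(** The coordinate z_o = 1 pads the monomials of degree less than two. *)
Lemma mpolyX_z (u : multinom m) : (mdeg u <= 2)%N ->
  exists a b, mpolyX R u = poly_z a * poly_z b.
Proof.
have split_mnm (v : multinom m) : (0 < mdeg v)%N ->
    exists i v', mpolyX R v = mpolyX R (mnm1 i) * mpolyX R v'
                 /\ mdeg v = (mdeg v').+1.
  move=> v0; have [i vi] : exists i, v i != 0%N.
    apply/existsP; apply: contraLR v0; rewrite negb_exists => /forallP v0.
    rewrite -leqNgt leqn0 mdegE sum_nat_eq0; apply/forallP => i.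
    by rewrite implyTb; have := v0 i; rewrite negbK.
  exists i, (mnm_sub v (mnm1 i)).
  have vE : v = mnm_add (mnm1 i) (mnm_sub v (mnm1 i)).
    rewrite addmC submK //; apply/mnm_lepP => j.
    by rewrite mnm1E; case: eqVneq => // <-; rewrite lt0n.
  by split; [rewrite -mpolyXD -vE | rewrite {1}vE mdegD mdeg1].
case E: (mdeg u) => [|[|[|//]]] _.
- exists None, None; rewrite /= mulr1; have /eqP := E.
  by rewrite mdeg_eq0 => /eqP ->; exact: mpolyX0.
- have [|i [v [-> uv]]] := split_mnm u; first by rewrite E.
  have /eqP : mdeg v = 0%N by move: uv; rewrite E => -[].
  rewrite mdeg_eq0 => /eqP ->; exists (Some i), None.
  by rewrite mpolyX0.
- have [|i [v [-> uv]]] := split_mnm u; first by rewrite E.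
  have vE : mdeg v = 1%N by move: uv; rewrite E => -[].
  have [|j [v' [-> vv']]] := split_mnm v; first by rewrite vE.
  have /eqP : mdeg v' = 0%N by move: vv'; rewrite vE => -[].
  rewrite mdeg_eq0 => /eqP ->; exists (Some i), (Some j).
  by rewrite mpolyX0 mulr1.
Qed.

(** The Lie derivative is linear in the Hamiltonian, and the products z_a z_b span the polynomials
    of degree at most two. *)
Lemma sp_stable_gen w (V : set tens) : V 0 ->
  (forall c S S', V S -> V S' -> V (cstT c * S + S')) ->
  (forall a b S, V S -> V (lie w (contact_ham (Az a * Az b)) S)) ->
  sp_stable w V.
Proof.
move=> V0 Vlin Vz Z [h h3 ->] S VS.
have -> : poly_fun h
    = \sum_(u <- msupp h) (mcoeff u h) *: poly_fun (mpolyX R u).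
  rewrite {1}[h]mpolyE /poly_fun raddf_sum; apply: eq_bigr => u _ /=.
  by rewrite mmapZ cst_funZ.
have : {in msupp h, forall u, (mdeg u <= 2)%N}.
  by move=> u /(mmeasure_mnm_lt mdeg) /leq_trans /(_ h3).
elim: (msupp h) => [|u r IH] hr.
  (* Linearity with coefficient - 1 at two zeros gives - y + y for the value y at zero, hence y = 0;
     the same device recurs below. *)
  rewrite big_nil; have := lie_linear w (- 1) 0 0 S.
  by rewrite scaler0 addr0 constTN1 mulN1r addNr => ->.
rewrite big_cons lie_linear; apply: Vlin; last first.
  by apply: IH => v vr; apply: hr; rewrite inE vr orbT.
have [|a [b ->]] := @mpolyX_z u; first by apply: hr; rewrite inE eqxx.
by rewrite poly_fun_z; exact: Vz.
Qed.

End SpAction.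

(** * The operators X and i_alpha on the graded modules R^k *)

Section TensorModules.
Local Open Scope classical_set_scope.
Local Open Scope ring_scope.
Context {R : realType} {n : nat}.
Local Notation m := (cdim n).
Local Notation A := (smooth_fun R m).
Local Notation tens := (mpoly m A).
Local Notation I := (option 'I_m).
Local Notation cstT := (@constT R n).
Local Notation Az := (@hom_z A 'I_m (fun i => Defs.coord i)).
Implicit Types (P Q S : tens) (f g h : A) (i j : 'I_m) (a b : I) (c delta w : R)
  (k l : nat).

(** The number c for R^k_delta: tensors there have homogeneity degree - c. It is also the
    coefficient of the last term of X. *)
Definition shift_weight delta k : R := 2%:R * n.+1%:R * delta + k%:R.
Local Notation cw := shift_weight.

Lemma shift_weightS delta k : cw delta k.+1 = cw delta k + 1.
Proof. by rewrite /cw -addrA natr1. Qed.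

Lemma lie_z delta k a b P : sym_tensor n k P ->
  lie (Rk_weight n delta k) (contact_ham (Az a * Az b)) P
  = spL (cw delta k) a b P.
Proof. exact: lie_spL. Qed.

Lemma spL_homog delta k a b P : sym_tensor n k P ->
  sym_tensor n k (spL (cw delta k) a b P).
Proof. by move=> hP; rewrite -lie_z //; exact: lie_homog. Qed.

Lemma opY_linear c c' P Q :
  opY c (cstT c' * P + Q) = cstT c' * opY c P + opY c Q.
Proof.
exact: (contact_op_linear _ _ _ _ (c := cstT c') (fun i => @dx_cst R n i c')).
Qed.

Lemma opJ_linear c' P Q : opJ (cstT c' * P + Q) = cstT c' * opJ P + opJ Q.
Proof.
exact: (contact_contr_linear _ _ _ (c := cstT c') (fun i => @dxi_cst R n i c')).
Qed.

Lemma gen_ham_linear delta k c P Q :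
  gen_ham delta k (cstT c * P + Q)
  = cstT c * gen_ham delta k P + gen_ham delta k Q.
Proof. by rewrite !gen_hamE opY_linear opprD mulrN. Qed.

Lemma i_alpha_linear c P Q :
  i_alpha (cstT c * P + Q) = cstT c * i_alpha P + i_alpha Q.
Proof. by rewrite !i_alphaE opJ_linear mulrDr mulrCA. Qed.

Lemma gen_ham0 delta k : gen_ham delta k (0 : tens) = 0.
Proof.
have := gen_ham_linear delta k (- 1) 0 0.
by rewrite mulr0 addr0 constTN1 mulN1r addNr.
Qed.

Lemma i_alpha0 : i_alpha (0 : tens) = 0.
Proof.
have := i_alpha_linear (- 1) 0 0.
by rewrite mulr0 addr0 constTN1 mulN1r addNr.
Qed.

Lemma gen_hamZ delta k c P :
  gen_ham delta k (cstT c * P) = cstT c * gen_ham delta k P.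
Proof. by rewrite -[_ * P]addr0 gen_ham_linear gen_ham0 addr0. Qed.

Lemma i_alphaZ c P : i_alpha (cstT c * P) = cstT c * i_alpha P.
Proof. by rewrite -[_ * P]addr0 i_alpha_linear i_alpha0 addr0. Qed.

Lemma sym_tensor_linear k c P Q : sym_tensor n k P -> sym_tensor n k Q ->
  sym_tensor n k (cstT c * P + Q).
Proof. by move=> hP hQ; apply: rpredD hQ; rewrite constTE; exact: dhomogZ. Qed.

Lemma sym_tensor0 k : sym_tensor n k (0 : tens).
Proof. exact: dhomog0. Qed.

Lemma gen_ham_homog delta k P : sym_tensor n k P ->
  sym_tensor n k.+1 (gen_ham delta k P).
Proof.
move=> hP; have xiM i Q : sym_tensor n k Q ->
    mpolyX A (mnm1 i) * Q \is ishomog1 k.+1 mdeg.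
  exact: dhomogM (xi_homog i).
rewrite gen_hamE /sym_tensor /= opYE rpredN; apply: rpredD; [apply: rpredD|].
- by apply: rpred_sum => j _; apply: rpredB; apply/xiM/dx_homog.
- apply: xiM; apply: rpredB; last by rewrite constTE; exact: dhomogZ.
  rewrite rpredN; apply: rpred_sum => i _; rewrite mul_mpolyC.
  exact/dhomogZ/dx_homog.
- rewrite mulr_suml; apply: rpred_sum => i _; rewrite -mulrA mul_mpolyC.
  exact/dhomogZ/xiM/dx_homog.
Qed.

Lemma i_alpha_homog k P : sym_tensor n k P -> sym_tensor n k.-1 (i_alpha P).
Proof.
move=> hP; rewrite i_alphaE constTE /sym_tensor /= opJE.
apply/dhomogZ/rpredB; last exact: dxi_homog.
apply: rpred_sum => j _; rewrite !mul_mpolyC.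
by apply: rpredB; apply/dhomogZ/dxi_homog.
Qed.

Lemma i_alpha_homog0 P : sym_tensor n 0 P -> i_alpha P = 0.
Proof.
move=> hP; rewrite i_alphaE opJE big1 => [|j _].
  by rewrite dxi_homog0 // subr0 mulr0.
by rewrite !dxi_homog0 // !mulr0 subr0.
Qed.

Lemma spL_linear c' a b c P Q :
  spL c' a b (cstT c * P + Q) = cstT c * spL c' a b P + spL c' a b Q.
Proof.
exact: (sp_op_linear _ _ _ _ (c := cstT c)
  (fun i => @dx_cst R n i c) (fun i => @dxi_cst R n i c)).
Qed.

Lemma spL0 c a b : spL c a b (0 : tens) = 0.
Proof.
have := spL_linear c a b (- 1) 0 0.
by rewrite mulr0 addr0 constTN1 mulN1r addNr.
Qed.

Lemma spLN c a b P : spL c a b (- P) = - spL c a b P.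
Proof.
have := spL_linear c a b (- 1) P 0.
by rewrite constTN1 !mulN1r spL0 !addr0.
Qed.

Lemma opJ_i_alpha P : opJ P = cstT 2%:R * i_alpha P.
Proof.
by rewrite i_alphaE mulrA -(rmorphM cstT) divff ?pnatr_eq0 // rmorph1 mul1r.
Qed.

Lemma gen_ham_spL delta k a b P :
  gen_ham delta k (spL (cw delta k) a b P)
  = spL (cw delta k.+1) a b (gen_ham delta k P).
Proof.
by rewrite !gen_hamE shift_weightS opY_spL spLN.
Qed.

Lemma i_alpha_spL0 c a b P : i_alpha P = 0 -> i_alpha (spL c a b P) = 0.
Proof.
move=> iP; rewrite i_alphaE -[c](subrK 1) opJ_spL opJ_i_alpha iP mulr0 spL0.
by rewrite mulr0.
Qed.

Lemma opY0 c : opY c (0 : tens) = 0.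
Proof.
have := opY_linear c (- 1) 0 0.
by rewrite mulr0 addr0 constTN1 mulN1r addNr.
Qed.

(** For k = 0 the truncated [k.-1] does not match the degree of [opY], but then [opJ P] is zero. *)
Lemma opY_opJ delta k P : sym_tensor n k P ->
  opY (cw delta k - 1) (opJ P) = - gen_ham delta k.-1 (opJ P).
Proof.
case: k => [|k] hP; last by rewrite gen_hamE opprK shift_weightS addrK.
by rewrite opJ_i_alpha (i_alpha_homog0 hP) mulr0 gen_ham0 oppr0 opY0.
Qed.

(** The commutator of [opJ] and [opY] is k + c = 2((n+1) delta + k); replacing [opJ] by 2 i_alpha
    and [opY] by - X halves it and changes its sign. *)
Lemma i_alpha_gen_ham delta k P : sym_tensor n k P ->
  i_alpha (gen_ham delta k P)
  = gen_ham delta k.-1 (i_alpha P) - cstT (n.+1%:R * delta + k%:R) * P.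
Proof.
move=> hP; rewrite [LHS]i_alphaE gen_hamE -[- opY _ _]mulN1r -constTN1.
rewrite -[_ * opY _ _]addr0 opJ_linear constTN1 mulN1r.
have -> : opJ (0 : tens) = 0 by rewrite opJ_i_alpha i_alpha0 mulr0.
rewrite addr0 -/(cw delta k) -[cw delta k](subrK 1) (opJ_opY _ hP) subrK.
rewrite (opY_opJ _ hP).
rewrite opprD opprK mulrDr -gen_hamZ -i_alphaE; congr (_ + _).
rewrite mulrN mulrA -(rmorphM cstT); congr (- (constT _ * _)).
by rewrite /cw mulrC; lra.
Qed.

End TensorModules.

(** * The Casimir operator on tensor fields *)

Section CasimirOperator.
Local Open Scope classical_set_scope.
Local Open Scope ring_scope.
Context {R : realType} {n : nat}.
Local Notation m := (cdim n).
Local Notation A := (smooth_fun R m).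
Local Notation tens := (mpoly m A).
Local Notation I := (option 'I_m).
Local Notation vfield := 'rV[A]_m.
Local Notation cstT := (@constT R n).
Local Notation Az := (@hom_z A 'I_m (fun i => Defs.coord i)).
Local Notation Z a b := (contact_ham (Az a * Az b) : vfield).
Local Notation cw := (@shift_weight R n).
Implicit Types (P Q S : tens) (a b : I) (c delta w : R) (k l : nat).

Lemma constTN c : cstT (- c) = - cstT c. Proof. exact: rmorphN. Qed.
Lemma constTB c c' : cstT (c - c') = cstT c - cstT c'.
Proof. exact: rmorphB. Qed.
Lemma constTD c c' : cstT (c + c') = cstT c + cstT c'.
Proof. exact: rmorphD. Qed.
Lemma constTM c c' : cstT (c * c') = cstT c * cstT c'.
Proof. exact: rmorphM. Qed.

Lemma constT_quadratic (r1 r2 r3 r4 : R) :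
  cstT (r1 * (r2 * (r2 - r3) + r4 * (r4 - r1 + r3)))
  = cstT r1 * (cstT r2 * (cstT r2 - cstT r3)
               + cstT r4 * (cstT r4 - cstT r1 + cstT r3)).
Proof. by rewrite !(constTM, constTD, constTN). Qed.

(* This is - 8 (n + 2) times the Casimir operator normalised by the Killing
   form. *)
Definition casimir w S : tens := \sum_(u : I * I)
  cstT ((-1) ^+ frame_sg u.1 * (-1) ^+ frame_sg u.2)
  * lie w (Z u.1 u.2) (lie w (Z (frame_dual u.1) (frame_dual u.2)) S).

(** The scalar part is the eigenvalue for l = 0, since i_alpha vanishes on R^(k,0). The factor 8
    arises because 4 Y J = - 8 X i_alpha. *)
Lemma casimirE delta k S : sym_tensor n k S ->
  casimir (Rk_weight n delta k) S
  = cstT (- 8%:R * (n + 2)%:R * casimir_eig n k 0 delta) * S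
    - cstT 8%:R * gen_ham delta k.-1 (i_alpha S).
Proof.
move=> hS.
have := casimir_contact_op (@frame_dualK n) (@frame_sg_dual n)
  (@tensor_phase R n)
  (fun i => @dx_cst R n i (cw delta k - 1))
  (fun i => @dxi_cst R n i (cw delta k - 1)) (tensor_euler hS).
have -> : @constT R n (cw delta k - 1) + 1 = cstT (cw delta k).
  by rewrite -constTS subrK.
rewrite /casimir_op pair_big => casE.
transitivity (\sum_(u : I * I) (-1) ^+ frame_sg u.1 * (-1) ^+ frame_sg u.2
  * spL (cw delta k) u.1 u.2
      (spL (cw delta k) (frame_dual u.1) (frame_dual u.2) S)).
  apply: eq_bigr => u _; rewrite !lie_z //; last exact: spL_homog.
  by rewrite (rmorphM cstT) !(rmorph_sign cstT).
apply: etrans casE _.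
have -> : 2%:R * (cstT (cw delta k) * (cstT (cw delta k) - #|{: I}|%:R)
      + k%:R * (k%:R - 2%:R + #|{: I}|%:R))
    = - cstT (- 8%:R * (n + 2)%:R * casimir_eig n k 0 delta).
  rewrite card_frame.
  have -> : - 8%:R * (n + 2)%:R * casimir_eig n k 0 delta
      = - (2%:R * (cw delta k * (cw delta k - (2 * n.+1)%:R)
                   + k%:R * (k%:R - 2%:R + (2 * n.+1)%:R))).
    have n2 : (n + 2)%:R != 0 :> R by rewrite pnatr_eq0 addn2.
    rewrite /casimir_eig /shift_weight mulrA mulfK //.
    by rewrite natrM; move: (n.+1%:R) => N; field.
  move: (cw delta k) => C.
  by rewrite constTN opprK constT_quadratic !cstT_nat.
rewrite [(- cstT _) * S]mulNr opprK -/(opJ S) -/(opY (cw delta k - 1) (opJ S)).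
rewrite (opY_opJ _ hS) opJ_i_alpha gen_hamZ; congr (_ + _).
rewrite mulrN mulrA; congr (- (_ * _)).
by rewrite !cstT_nat -natrM.
Qed.

Lemma sym_map_sum k (T : tens -> tens) (J : finType) (c : J -> R)
    (F : J -> tens) :
  (forall c S1 S2, sym_tensor n k S1 -> sym_tensor n k S2 ->
     T (cst_fun c *: S1 + S2) = cst_fun c *: T S1 + T S2) ->
  (forall u, sym_tensor n k (F u)) ->
  T (\sum_u cstT (c u) * F u) = \sum_u cstT (c u) * T (F u).
Proof.
move=> Tlin hF.
have T0 : T 0 = 0.
  have := Tlin (- 1) 0 0 (sym_tensor0 k) (sym_tensor0 k).
  by rewrite -!constTE mulr0 addr0 constTN1 mulN1r addNr.
elim: (index_enum J) => [|u r IH]; first by rewrite !big_nil.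
rewrite !big_cons constTE Tlin ?IH -?constTE //.
elim: r {IH} => [|v r IH]; first by rewrite big_nil; exact: sym_tensor0.
by rewrite big_cons; exact: sym_tensor_linear.
Qed.

(** Both Casimir operators use the same fields and signs, so T passes through each product of two
    Lie derivatives; the intermediate tensor stays in degree k. *)
Lemma sp_invariant_casimir delta delta' k k' (T : tens -> tens) S :
  sp_invariant (Rk_weight n delta k) (Rk_weight n delta' k')
    (sym_tensor n k) (sym_tensor n k') T ->
  sym_tensor n k S ->
  T (casimir (Rk_weight n delta k) S) = casimir (Rk_weight n delta' k') (T S).
Proof.
move=> [TV Tlin Tinv] hS; rewrite /casimir (sym_map_sum _ Tlin) => [|u].
  apply: eq_bigr => u _; congr (_ * _); have ha := @sp_alg_z R n.
  by rewrite Tinv ?Tinv //; exact: lie_homog.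
exact/lie_homog/lie_homog.
Qed.

End CasimirOperator.

(** * Eigenspaces of the Casimir operator *)

Section EigenspaceDecomposition.
Local Open Scope classical_set_scope.
Local Open Scope ring_scope.
Context {R : realType} {n : nat}.
Local Notation m := (cdim n).
Local Notation A := (smooth_fun R m).
Local Notation tens := (mpoly m A).
Local Notation I := (option 'I_m).
Local Notation cstT := (@constT R n).
Local Notation cw := (@shift_weight R n).
Implicit Types (P Q S U : tens) (a b : I) (c delta w mu : R) (j k l p : nat).

(** The ring of tensors has zero divisors; the argument inverts the constant c - c' instead of
    cancelling U. *)
Lemma constT_inj c c' U : U != 0 -> cstT c * U = cstT c' * U -> c = c'.
Proof.
move=> U0 /eqP; rewrite -subr_eq0 -mulrBl -constTB => /eqP E.
apply/eqP; rewrite -subr_eq0; apply: contraNT U0 => cc.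
have := congr1 (fun V => cstT (c - c')^-1 * V) E.
by rewrite /= mulrA -constTM mulVf // mulr0 rmorph1 mul1r => ->.
Qed.

Lemma gen_ham_iter_linear delta j l c P Q :
  gen_ham_iter delta j l (cstT c * P + Q)
  = cstT c * gen_ham_iter delta j l P + gen_ham_iter delta j l Q.
Proof. by elim: l => //= l ->; rewrite gen_ham_linear. Qed.

Lemma gen_ham_iter_homog delta j l P : sym_tensor n j P ->
  sym_tensor n (j + l) (gen_ham_iter delta j l P).
Proof.
move=> hP; elim: l => [|l IH] /=; first by rewrite addn0.
by rewrite addnS; exact: gen_ham_homog.
Qed.

Lemma gen_ham_iter_spL delta j l a b P :
  gen_ham_iter delta j l (spL (cw delta j) a b P)
  = spL (cw delta (j + l)) a b (gen_ham_iter delta j l P).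
Proof.
elim: l => [|l IH] /=; first by rewrite addn0.
rewrite addnS IH; exact: gen_ham_spL.
Qed.

Lemma Rkl_homog delta k l S : (l <= k)%N ->
  Rkl n delta k l S -> sym_tensor n k S.
Proof.
move=> lk [P [hP _] <-]; rewrite -[X in sym_tensor n X](subnK lk).
exact: gen_ham_iter_homog.
Qed.

Lemma Rkl_linear delta k l c S S' : Rkl n delta k l S -> Rkl n delta k l S' ->
  Rkl n delta k l (cstT c * S + S').
Proof.
move=> [P [hP iP] <-] [Q [hQ iQ] <-]; exists (cstT c * P + Q).
  split; first exact: sym_tensor_linear.
  by rewrite /= i_alpha_linear iP iQ mulr0 addr0.
exact: gen_ham_iter_linear.
Qed.

Lemma Rkl0 delta k l : Rkl n delta k l (0 : tens).
Proof.
exists 0; first by split; [exact: sym_tensor0 | exact: i_alpha0].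
have := gen_ham_iter_linear delta (k - l) l (- 1) 0 0.
by rewrite mulr0 addr0 constTN1 mulN1r addNr.
Qed.

Lemma RklZ delta k l c S : Rkl n delta k l S -> Rkl n delta k l (cstT c * S).
Proof.
by move=> hS; rewrite -[_ * S]addr0; apply: Rkl_linear hS (Rkl0 _ _ _).
Qed.

Lemma Rkl_stable delta k l : (l <= k)%N ->
  sp_stable (Rk_weight n delta k) (Rkl n delta k l : set tens).
Proof.
move=> lk; apply: sp_stable_gen => [|c S S'|a b S hS].
- exact: Rkl0.
- exact: Rkl_linear.
rewrite lie_z; last exact: Rkl_homog hS.
case: hS => P [hP iP] <-; exists (spL (cw delta (k - l)) a b P).
  by split; [exact: spL_homog | exact: i_alpha_spL0].
by rewrite gen_ham_iter_spL subnK.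
Qed.

(** The eigenvalue of X i_alpha on R^(k,l): minus the sum of (n+1) delta + i for k - l <= i < k. *)
Definition ladder_eig delta k l : R :=
  - (l%:R * (n.+1%:R * delta)) - l%:R * (2%:R * k%:R - l%:R - 1) / 2%:R.

Lemma ladder_eig0 delta k : ladder_eig delta k 0 = 0.
Proof. by rewrite /ladder_eig !mul0r subr0 oppr0. Qed.

Lemma constT0 U : cstT 0 * U = 0.
Proof. by rewrite rmorph0 mul0r. Qed.

(** Moving i_alpha through the powers of X leaves one commutator constant per factor, and P is
    annihilated at the end. *)
Lemma i_alpha_gen_ham_iter delta j l P : sym_tensor n j P -> i_alpha P = 0 ->
  i_alpha (gen_ham_iter delta j l.+1 P)
  = cstT (ladder_eig delta (j + l.+1) l.+1) * gen_ham_iter delta j l P.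
Proof.
move=> hP iP; elim: l => [|l IH].
  rewrite /= addn0 (i_alpha_gen_ham _ hP) iP gen_ham0 sub0r -mulNr -constTN.
  congr (constT _ * _); rewrite /ladder_eig addn1 -[j.+1%:R]natr1.
  by move: n.+1%:R => N; field.
pose Q := gen_ham_iter delta j l.+1 P.
have hQ : sym_tensor n (j + l.+1) Q by exact: gen_ham_iter_homog.
have QE : gen_ham delta (j + l.+1).-1 (gen_ham_iter delta j l P) = Q.
  by rewrite addnS.
rewrite -[LHS]/(i_alpha (gen_ham delta (j + l.+1) Q)) (i_alpha_gen_ham _ hQ).
rewrite [i_alpha Q]IH gen_hamZ QE -mulrBl -constTB; congr (constT _ * _).
rewrite /ladder_eig !natrD -[l.+2%:R]natr1 -[l.+1%:R]natr1.
by move: n.+1%:R => N; field.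
Qed.

Lemma gen_ham_iter_eigen delta j l P : sym_tensor n j P -> i_alpha P = 0 ->
  gen_ham delta (j + l).-1 (i_alpha (gen_ham_iter delta j l P))
  = cstT (ladder_eig delta (j + l) l) * gen_ham_iter delta j l P.
Proof.
move=> hP iP; case: l => [|l].
  by rewrite ladder_eig0 constT0 [gen_ham_iter _ _ _ _]/= iP gen_ham0.
have -> : (j + l.+1).-1 = (j + l)%N by rewrite addnS.
by rewrite (i_alpha_gen_ham_iter _ _ hP iP) gen_hamZ.
Qed.

Lemma Rkl_eigen delta k l S : (l <= k)%N -> Rkl n delta k l S ->
  gen_ham delta k.-1 (i_alpha S) = cstT (ladder_eig delta k l) * S.
Proof.
move=> lk [P [hP iP] <-]; have := gen_ham_iter_eigen delta l hP iP.
by rewrite (subnK lk).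
Qed.

Lemma critical_setS delta k :
  ~ critical_set n k.+1 delta -> ~ critical_set n k delta.
Proof. by move=> reg [p pk E]; apply: reg; exists p => //; lia. Qed.

(** Equality would mean that the eigenvalue for (k+1, l+1) is zero, the eigenvalue for (k+1, 0). *)
Lemma ladder_eig_regular delta k l : (l <= k)%N ->
  ~ critical_set n k.+1 delta ->
  ladder_eig delta k l <> n.+1%:R * delta + k%:R.
Proof.
(* The equality factors as (l+1) ((n+1) delta + (2k-l)/2) = 0, which gives the numerator 2k - l. *)
move=> lk reg E; apply: reg; exists (2 * k - l)%N; first by lia.
have N0 : n.+1%:R != 0 :> R by rewrite pnatr_eq0.
have l0 : l%:R + 1 != 0 :> R by rewrite natr1 pnatr_eq0.
rewrite natrB ?natrM; last by lia.
apply: (mulfI l0); apply: (mulfI N0); move: E; rewrite /ladder_eig.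
move: n.+1%:R N0 l0 => N N0 l0 E.
have -> : N * ((l%:R + 1) * (- ((2%:R * k%:R - l%:R) / (2%:R * N))))
  = - ((l%:R + 1) * (2%:R * k%:R - l%:R)) / 2%:R :> R by field.
lra.
Qed.

(** If i_alpha U = 0, then l = 0. Otherwise i_alpha U lies in some R^(k-1,l) and mu is nonzero, so
    the eigenvalue equation recovers U as X applied to i_alpha U, up to the factor 1/mu. *)
Lemma eigen_Rkl delta k mu U : ~ critical_set n k delta ->
  sym_tensor n k U -> U != 0 ->
  gen_ham delta k.-1 (i_alpha U) = cstT mu * U ->
  exists l, [/\ (l <= k)%N, Rkl n delta k l U & mu = ladder_eig delta k l].
Proof.
elim: k mu U => [|k IH] mu U reg hU U0 E.
  exists 0%N; split=> //.
    by exists U => //; split=> //; exact: i_alpha_homog0.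
  apply: (constT_inj U0); rewrite -E (i_alpha_homog0 hU) gen_ham0.
  by rewrite ladder_eig0 constT0.
have reg' := critical_setS reg.
have hi := i_alpha_homog hU.
(* Applying i_alpha to the eigenvalue equation shifts the eigenvalue by the commutator constant. *)
have Ei : gen_ham delta k.-1 (i_alpha (i_alpha U))
    = cstT (mu + (n.+1%:R * delta + k%:R)) * i_alpha U.
  have := congr1 i_alpha E; rewrite (i_alpha_gen_ham _ hi) i_alphaZ => /eqP.
  by rewrite subr_eq -mulrDl -constTD => /eqP.
have [iU0|iU0] := eqVneq (i_alpha U) 0.
  exists 0%N; split=> //; first by exists U.
  apply: (constT_inj U0); rewrite -E iU0 gen_ham0.
  by rewrite ladder_eig0 constT0.
have [l [lk hl El]] := IH _ _ reg' hi iU0 Ei.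
have mu0 : mu != 0.
  apply/eqP => mu0; apply: (ladder_eig_regular lk reg).
  by rewrite -El mu0 add0r.
exists l.+1; split=> //.
  have -> : U = cstT mu^-1 * gen_ham delta k (i_alpha U).
    by rewrite E mulrA -constTM mulVf // rmorph1 mul1r.
  apply: RklZ; case: hl => P [hP iP] <-; exists P; rewrite ?subSS //.
  by rewrite /= subnK.
move: El => /(canRL (addrK _)) ->; rewrite /ladder_eig -[l.+1%:R]natr1.
by rewrite -[k.+1%:R]natr1; field.
Qed.

Lemma casimir_eig_ladder delta k l :
  (n + 2)%:R * casimir_eig n k l delta
  = (n + 2)%:R * casimir_eig n k 0 delta + ladder_eig delta k l :> R.
Proof.
have n2 : (n + 2)%:R != 0 :> R by rewrite pnatr_eq0 addn2.
rewrite /casimir_eig /ladder_eig !mulrA !mulfV // !mul1r.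
by move: n.+1%:R => N; field.
Qed.

Lemma casimir_eig_inj delta k l l' : ~ critical_set n k delta ->
  (l <= k)%N -> (l' <= k)%N ->
  casimir_eig n k l delta = casimir_eig n k l' delta -> l = l'.
Proof.
move=> reg lk l'k /(congr1 (fun r => (n + 2)%:R * r)).
rewrite (casimir_eig_ladder delta k l) (casimir_eig_ladder delta k l').
move=> /addrI E.
(* The difference of the eigenvalues is - (l-l') ((n+1) delta + (2k-1-l-l')/2). As l and l' are
   distinct, 1 <= l + l' <= 2k-1, so the numerator lies between 0 and 2k-2. *)
apply/eqP/negP => /negP ll'; apply: reg; exists (2 * k - 1 - l - l')%N.
  by move/eqP: ll' => ll'; lia.
have d0 : l%:R - l'%:R != 0 :> R by rewrite subr_eq0 eqr_nat.
have N0 : n.+1%:R != 0 :> R by rewrite pnatr_eq0.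
have -> : (2 * k - 1 - l - l')%:R = 2%:R * k%:R - 1 - l%:R - l'%:R :> R.
  by move/eqP: ll' => ll'; rewrite !natrB ?natrM //; lia.
apply: (mulfI d0); apply: (mulfI N0); move: E; rewrite /ladder_eig.
move: n.+1%:R N0 d0 => N N0 d0 E.
have -> : N * ((l%:R - l'%:R)
    * (- ((2%:R * k%:R - 1 - l%:R - l'%:R) / (2%:R * N))))
  = - ((l%:R - l'%:R) * (2%:R * k%:R - 1 - l%:R - l'%:R)) / 2%:R :> R by field.
lra.
Qed.

Lemma casimir_Rkl delta k l S : (l <= k)%N -> Rkl n delta k l S ->
  casimir (Rk_weight n delta k) S
  = cstT (- 8%:R * ((n + 2)%:R * casimir_eig n k l delta)) * S.
Proof.
move=> lk hS; rewrite (casimirE _ (Rkl_homog lk hS)) (Rkl_eigen lk hS).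
rewrite mulrA -constTM -mulrBl -constTB casimir_eig_ladder.
by congr (constT _ * _); ring.
Qed.

(** T S inherits the Casimir eigenvalue of S, so it is an eigenvector of X i_alpha and [eigen_Rkl]
    applies. The l' obtained here may still depend on S. *)
Lemma sp_invariant_Rkl delta delta' k k' l (T : tens -> tens) S :
  sp_invariant (Rk_weight n delta k) (Rk_weight n delta' k')
    (sym_tensor n k) (sym_tensor n k') T ->
  ~ critical_set n k' delta' -> (l <= k)%N ->
  Rkl n delta k l S -> T S != 0 ->
  exists l', [/\ (l' <= k')%N, Rkl n delta' k' l' (T S) &
    casimir_eig n k' l' delta' = casimir_eig n k l delta].
Proof.
move=> T_inv reg lk hS TS0; have [TV Tlin _] := T_inv.
have hTS := TV _ (Rkl_homog lk hS).
have := sp_invariant_casimir T_inv (Rkl_homog lk hS).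
rewrite (casimir_Rkl lk hS) (casimirE _ hTS).
set e := casimir_eig n k l delta; set e0 := casimir_eig n k' 0 delta'.
have -> : T (cstT (- 8%:R * ((n + 2)%:R * e)) * S)
    = cstT (- 8%:R * ((n + 2)%:R * e)) * T S.
  have T0 : T 0 = 0.
    have := Tlin (- 1) 0 0 (sym_tensor0 k) (sym_tensor0 k).
    by rewrite -!constTE mulr0 addr0 constTN1 mulN1r addNr.
  have := Tlin (- 8%:R * ((n + 2)%:R * e)) S 0 (Rkl_homog lk hS)
    (sym_tensor0 k).
  by rewrite T0 !addr0 -!constTE.
set G := gen_ham _ _ _ => E.
(* The formula of [casimirE] solved for X i_alpha (T S). *)
have GE : G = cstT ((n + 2)%:R * e - (n + 2)%:R * e0) * T S.
  have -> : (n + 2)%:R * e - (n + 2)%:R * e0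
      = 8%:R^-1 * (- 8%:R * (n + 2)%:R * e0 - - 8%:R * ((n + 2)%:R * e)).
    by field.
  rewrite constTM constTB -mulrA mulrBl E opprB addrC subrK.
  by rewrite mulrA -constTM mulVf ?pnatr_eq0 // rmorph1 mul1r.
have [l' [l'k hl' El']] := eigen_Rkl reg hTS TS0 GE; exists l'; split=> //.
have n2 : (n + 2)%:R != 0 :> R by rewrite pnatr_eq0 addn2.
by apply: (mulfI n2); rewrite casimir_eig_ladder -El' addrC subrK.
Qed.

End EigenspaceDecomposition.

Theorem proposition6 (R : realType) (n : nat) (n_ge1 : (1 <= n)%N)
    (k k' : nat) (delta delta' : R)
    (T : mpoly (cdim n) (smooth_fun R (cdim n)) ->
         mpoly (cdim n) (smooth_fun R (cdim n)))
    (T_inv : sp_invariant (Rk_weight n delta k) (Rk_weight n delta' k')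
               (sym_tensor n k) (sym_tensor n k') T)
    (delta_reg : ~ critical_set n k delta)
    (delta'_reg : ~ critical_set n k' delta') :
  (forall l : 'I_k.+1,
     vanishes_on (Rkl n delta k l) T \/
     exists! l' : 'I_k'.+1, component_map k k' delta delta' T l l') /\
  (forall (l1 l2 : 'I_k.+1) (l' : 'I_k'.+1),
     ~ vanishes_on (Rkl n delta k l1) T -> ~ vanishes_on (Rkl n delta k l2) T ->
     component_map k k' delta delta' T l1 l' ->
     component_map k k' delta delta' T l2 l' ->
     l1 = l2).
Proof.
have [_ Tlin Tinv] := T_inv.
split=> [l|l1 l2 l' _ _ [_ _ _ E1] [_ _ _ E2]]; last first.
  (* The eigenvalues for l1 and l2 both equal that for l', and regularity of delta separates
     them. *)
  apply/val_inj/(casimir_eig_inj delta_reg (ltn_ord l1) (ltn_ord l2)).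
  exact: etrans (esym E1) E2.
have lk : (l <= k)%N := ltn_ord l.
have [vT|nvT] := pselect (vanishes_on (Rkl n delta k l) T); [by left | right].
have [S hS TS0] : exists2 S, Rkl n delta k l S & T S != 0%R.
  apply: contrapT => nS; apply: nvT => S hS; apply/eqP/negPn/negP => TS0.
  by apply: nS; exists S.
have [l' [l'k hl' El']] := sp_invariant_Rkl T_inv delta'_reg lk hS TS0.
(* The index found for S serves for every S': all nonzero images have the same Casimir eigenvalue,
   which determines l' because delta' is regular. *)
have TR S' : Rkl n delta k l S' -> Rkl n delta' k' l' (T S').
  move=> hS'; have [->|TS'0] := eqVneq (T S') 0%R; first exact: Rkl0.
  have [l2 [l2k hl2 El2]] := sp_invariant_Rkl T_inv delta'_reg lk hS' TS'0.
  by rewrite (casimir_eig_inj delta'_reg l'k l2k) // El' El2.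
have l'k1 : (l' < k'.+1)%N by [].
exists (Ordinal l'k1); split=> [|l2 [_ _ _ El2]].
  split=> //; [exact: Rkl_stable | exact: Rkl_stable | split=> //].
    move=> c S1 S2 h1 h2.
    by apply: Tlin; [exact: Rkl_homog h1 | exact: Rkl_homog h2].
  by move=> Z S' hZ hS'; apply: Tinv => //; exact: Rkl_homog hS'.
apply/val_inj/(casimir_eig_inj delta'_reg l'k (ltn_ord l2)).
exact: etrans El' (esym El2).
Qed.
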